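(* Let $G=(V,E)$ be a connected, locally finite, infinite, transitive graph, let $p_c(G)\leq p_0<1$ and let $d\in(1,\infty]$. The following are equivalent: (i) For each $p_0<p\leq 1$ and $1<d'<d$ there exists a positive constant $c=c(p,d')$ such that $$\mathbb{P}_p(S\nleftrightarrow\infty)\leq \exp\left[-c|S|^{(d'-1)/d'}\right]$$ for every finite, non-empty set $S\subseteq V$. (ii) For each $p_0<p\leq 1$ and $1<d'<d$ there exists a positive constant $c=c(p,d')$ such that $$\sum_{e\in\partial_E^\rightarrow S}\mathbb{P}_p\left(e^+\leftrightarrow\infty\text{ off }S\right)\geq c|S|^{(d'-1)/d'}$$ for every finite, non-empty set $S\subseteq V$. (iii) For each $p_0<p\leq 1$ and $1<d'<d$ there exists a positive constant $c=c(p,d')$ such that $$\mathbb{P}_p(n\leq |K_v|<\infty)\leq \exp\left[-cn^{(d'-1)/d'}\right]$$ for every $v\in V$ and $n\geq 1$. (iv) For each $p_0<p\leq 1$, every infinite cluster of $G_p$ has anchored isoperimetric dimension at least $d$ almost surely. Moreover, the equivalence (i) $\Leftrightarrow$ (ii) and the implications (ii) $\Rightarrow$ (iii) $\Rightarrow$ (iv) do not require transitivity: they hold for any connected, infinite graph $G$ of bounded degree (with $p_c(G)\leq p_0<1$ and $d\in(1,\infty]$).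
   Context: Bernoulli bond percolation: each edge of $G$ is independently open (retained) with probability $p\in[0,1]$ and closed (deleted) otherwise; $G_p$ is the random subgraph of open edges, $\mathbb{P}_p$ its law, and clusters are the connected components of $G_p$. $K_v$ denotes the cluster of $v$, and $|K_v|$ its number of vertices. The critical probability is $p_c(G)=\inf\{p\in[0,1]: G_p\text{ has an infinite cluster almost surely}\}$. A graph is transitive if for any two vertices $u,v$ there is a graph automorphism mapping $u$ to $v$. For $S\subseteq V$, $\{S\leftrightarrow\infty\}$ is the event that $S$ is connected to infinity by an open path (i.e. some vertex of $S$ lies in an infinite cluster), and $\{S\nleftrightarrow\infty\}$ is its complement. For $v\notin S$, $\{v\leftrightarrow\infty\text{ off }S\}$ is the event that $v$ is connected to infinity by an open path that does not visit any vertex of $S$. Each edge is thought of as a pair of oriented edges; an oriented edge $e$ goes from $e^-$ to $e^+$, and $\partial_E^\rightarrow S$ is the set of oriented edges $e$ with $e^-\in S$ and $e^+\notin S$. For $d>1$, a connected, locally finite graph $H$ satisfies an anchored $d$-dimensional isoperimetric inequality if for some (equivalently every) vertex $v$ of $H$ there is a constant $c(v)>0$ such that $|\partial_E W|\geq c(v)\left(\sum_{w\in W}\deg(w)\right)^{(d-1)/d}$ for every finite connected set $W$ of vertices of $H$ containing $v$, where $\partial_E W$ is the set of edges of $H$ with exactly one endpoint in $W$ and $\deg$ is the degree in $H$. The anchored isoperimetric dimension of $H$ is the supremum of the $d$ for which $H$ satisfies an anchored $d$-dimensional isoperimetric inequality. In (iv) this is applied with $H$ an infinite cluster of $G_p$,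 viewed as a graph with its open edges. *)

(* Defs.v *)
From mathcomp Require Import all_boot all_order all_algebra finmap.
From mathcomp Require Import all_classical all_reals all_analysis.

Set Implicit Arguments.
Unset Strict Implicit.
Unset Printing Implicit Defensive.

Import Order.TTheory GRing.Theory Num.Theory.

Local Open Scope fset_scope.
Local Open Scope classical_set_scope.
Local Open Scope ring_scope.

Record graph (V : choiceType) := Graph {
  adj :> rel V ;
  adj_sym : symmetric adj ;
  adj_irr : irreflexive adj }.

Section Graphs.
Variables (V : choiceType) (G : graph V).

Definition neighbours (v : V) : set V := [set u | adj G v u].

Definition locally_finite := forall v, finite_set (neighbours v).

(* only meaningful at vertices with finitely many neighbours: [fset_set] sends
   an infinite set to the empty one *)
Definition degree (v : V) : nat := #|` fset_set (neighbours v)|.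

Definition bounded_degree :=
  exists D : nat, forall v, finite_set (neighbours v) /\ (degree v <= D)%N.

Definition component (v : V) : set V :=
  [set u | exists2 s : seq V, path (adj G) v s & last v s = u].

Definition connected_graph := forall u v, component u v.

Definition vertex_transitive := forall u v, exists f : V -> V,
  [/\ bijective f, forall x y, adj G (f x) (f y) = adj G x y & f u = v].

Definition is_edge (e : {fset V}) : bool :=
  `[< exists x y, adj G x y /\ e = [fset x; y] >].

Definition edge := {e : {fset V} | is_edge e}.

Definition edge_boundary (W : {fset V}) : set edge :=
  [set e | exists x y, [/\ val e = [fset x; y], x \in W & y \notin W]].

(* an oriented edge is the pair (e^-, e^+) of its endpoints *)
Definition oriented_boundary (S : {fset V}) : set (V * V) :=
  [set e | [/\ adj G e.1 e.2, e.1 \in S & e.2 \notin S]].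

Definition induced_adj (A : set V) : rel (set_type A) :=
  [rel x y | adj G (val x) (val y)].

Lemma induced_adj_sym (A : set V) : symmetric (@induced_adj A).
Proof. by move=> x y; exact: adj_sym. Qed.

Lemma induced_adj_irr (A : set V) : irreflexive (@induced_adj A).
Proof. by move=> x; exact: adj_irr. Qed.

Definition induced (A : set V) : graph (set_type A) :=
  Graph (@induced_adj_sym A) (@induced_adj_irr A).

End Graphs.

Arguments edge_boundary {V} G W.

Section AnchoredIsoperimetry.
Variables (R : realType) (V : choiceType) (H : graph V).

Definition anchored_isoperimetric (d : R) := exists v : V, exists2 c : R,
  0 < c & forall W : {fset V}, v \in W -> connected_graph (induced H [set` W]) ->
    c * ((\sum_(w <- W) degree H w)%N%:R `^ ((d - 1) / d))
      <= #|` fset_set (edge_boundary H W)|%:R.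

Definition anchored_dimension : \bar R :=
  ereal_sup [set d%:E | d in [set d : R | 1 < d /\ anchored_isoperimetric d]].

End AnchoredIsoperimetry.

Section Percolation.
Variables (V : choiceType) (G : graph V).

Definition edge_events : set (set (edge G -> bool)) :=
  [set C | exists e b, C = [set w | w e = b]].

(* configurations ([true] = open), with the product sigma-algebra *)
Definition config := g_sigma_algebraType edge_events.

Section OpenSubgraph.
Variable w : config.

Definition open_adj : rel V :=
  [rel x y | `[< exists2 e : edge G, val e = [fset x; y] & w e >]].

Lemma open_adj_sym : symmetric open_adj.
Proof. by move=> x y; rewrite /open_adj /= fsetUC. Qed.

Lemma open_adj_irr : irreflexive open_adj.
Proof.
move=> x; apply/negbTE/asboolP => -[[e /= Ge] /= exx _].
have /asboolP[a [b [Gab eab]]] := Ge.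
have : a \in [fset x; x] by rewrite -exx eab !inE eqxx.
have : b \in [fset x; x] by rewrite -exx eab !inE eqxx orbT.
by rewrite !inE !orbb => /eqP ? /eqP ?; subst a b; rewrite adj_irr in Gab.
Qed.

Definition open_subgraph : graph V := Graph open_adj_sym open_adj_irr.

Definition cluster (v : V) : set V := component open_subgraph v.

Definition cluster_graph (v : V) : graph (set_type (cluster v)) :=
  induced open_subgraph (cluster v).

Definition to_infinity (S : {fset V}) :=
  exists2 v, v \in S & infinite_set (cluster v).

Definition to_infinity_off (v : V) (S : {fset V}) := exists f : nat -> V,
  [/\ injective f, f 0%N = v, forall n, f n \notin S
    & forall n, adj open_subgraph (f n) (f n.+1)].

End OpenSubgraph.

Variable R : realType.

(* The finite-dimensional marginals say that edges are independently open with
   probability p; they determine the law. *)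
Definition bernoulli_percolation (p : R) (P : probability config R) :=
  forall (A : {fset edge G}) (s : edge G -> bool),
    P [set w | forall e, e \in A -> w e = s e] =
      (\prod_(e <- A) (if s e then p else 1 - p))%:E.

Variable P : R -> probability config R.

Definition critical_probability : R :=
  inf [set p : R | 0 <= p <= 1 /\
    {ae P p, forall w, exists v, infinite_set (cluster w v)}].

Variables (p0 : R) (d : \bar R).

Definition disconnection_decay := forall p d' : R,
  p0 < p <= 1 -> 1 < d' -> (d'%:E < d)%E ->
  exists2 c : R, 0 < c & forall S : {fset V}, S != fset0 ->
    (P p [set w | ~ to_infinity w S]
      <= (expR (- (c * #|` S|%:R `^ ((d' - 1) / d'))))%:E)%E.

Definition boundary_escape := forall p d' : R,
  p0 < p <= 1 -> 1 < d' -> (d'%:E < d)%E ->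
  exists2 c : R, 0 < c & forall S : {fset V}, S != fset0 ->
    ((c * #|` S|%:R `^ ((d' - 1) / d'))%:E
      <= \sum_(e \in oriented_boundary G S)
           P p [set w | to_infinity_off w e.2 S])%E.

Definition finite_cluster_decay := forall p d' : R,
  p0 < p <= 1 -> 1 < d' -> (d'%:E < d)%E ->
  exists2 c : R, 0 < c & forall (v : V) (n : nat), (1 <= n)%N ->
    (P p [set w | finite_set (cluster w v) /\
                  (n <= #|` fset_set (cluster w v)|)%N]
      <= (expR (- (c * n%:R `^ ((d' - 1) / d'))))%:E)%E.

Definition clusters_anchored_dimension := forall p : R, p0 < p <= 1 ->
  {ae P p, forall w, forall v, infinite_set (cluster w v) ->
    (d <= anchored_dimension R (cluster_graph w v))%E}.

End Percolation.

(* Main.v *)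
Require Import Defs.
From mathcomp Require Import all_boot all_order all_algebra finmap.
From mathcomp Require Import all_classical all_reals all_analysis.
From mathcomp Require Import measurable_realfun ring lra.
(* again last, so that [cluster] is that of a configuration and not of a filter *)
Require Import Defs.

(** Write [alpha = (d' - 1) / d'], and say that an edge leaving a finite set [S]
    escapes if its outer endpoint is connected to infinity off [S]; the escaping
    edges depend only on edges that do not touch [S]. [boundary_escape] bounds
    below their expected number [mean_escape], and is compared with the other
    three properties.

    [disconnection_decay] => [boundary_escape]: [disconnection_decay_escape]. [S] is disconnected from infinity as
    soon as the escaping edges are closed, and these edges touch [S]. If there are
    [N] escaping edges, this has conditional probability [(1 - p) ^ N], so that
    Jensen's inequality gives [P (S not <-> oo) >= (1 - p) ^ (mean_escape S)] for
    [p < 1]; at [p = 1] use that [mean_escape] increases with [p].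

    [boundary_escape] => [disconnection_decay] and [finite_cluster_decay]:
    [Pr_finite_hull_le]. Realise percolation at [p] as the
    union of a configuration [w] at some [p1] in [(p0, p)] and of an independent
    sprinkling of density [q]. Let [X_A] be the event that the sprinkled cluster
    [K] of [S] is the finite set [A], and explore, given [w], the cluster of [S]
    off the infinite clusters of [w]; let [E_A] be the event that this exploration
    finds [A]. On [X_A], [E_A] occurs and every edge leaving [A] that escapes in
    [w] is closed in the sprinkling. Such edges touch infinite clusters of [w],
    hence are not inspected by the exploration, and for a number [N_A] of them this
    costs [(1 - q) ^ N_A <= expR (- q N_A)]. On the other hand, [N_A] is
    independent of [X_A], so that Jensen's inequality yields
    [P (X_A) * expR (q * mean_escape A) <= P (E_A)]. The events [E_A] are
    disjoint; summing over [#|A| >= n] gives [P (n <= #|K| < oo) <= expR (- c n ^ alpha)].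
    With [n = #|S|] this is [disconnection_decay]; when [S] is a single vertex it is
    [finite_cluster_decay].

    Good vertices => [boundary_escape]: [good_mean_escape]. Call a vertex good if its cluster is
    infinite and satisfies, anchored at that vertex, the isoperimetric inequality
    with a fixed constant. Enlarge the part of the cluster in [S] by the finite
    pieces hanging off it; the open boundary of what is obtained consists of
    escaping edges, and isoperimetry bounds it below. Summing over the pieces, which
    partition [S], and using concavity of [x ^ alpha], there are at least
    [c #|S| ^ (alpha - 1)] escaping edges per good vertex of [S]. So [boundary_escape]
    holds once vertices are good with probability bounded below.

    [finite_cluster_decay] => [boundary_escape] and [clusters_anchored_dimension], for
    bounded degree: [Pr_bad_small]. Let [p < 1]. Closing
    the open boundary edges of a connected set [W] of [m] vertices that has at most
    [k = m ^ alpha'] of them, [alpha' < alpha], makes it a cluster; since these edges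
    can be chosen in at most [(C m) ^ k] ways, this shows that such a [W] around [v]
    exists with probability at most [(C m) ^ k * expR (- c m ^ alpha)], which is
    summable. This gives [clusters_anchored_dimension] at [p < 1]; and since
    [finite_cluster_decay] at [n = 1] bounds the probability
    of an infinite cluster from below, vertices are good with probability bounded
    below uniformly, whence [boundary_escape]. At [p = 1], the dimension is that of [G]
    itself, and the bound on it is contained in [boundary_escape].

    [clusters_anchored_dimension] => [boundary_escape], for transitive graphs:
    [dimension_escape]. Above the critical
    probability some vertex has an infinite cluster with positive probability. By
    hypothesis it is good for some constant with positive probability, and by invariance
    under automorphisms so is every vertex, with the same probability. *)

Set Implicit Arguments.
Unset Strict Implicit.
Unset Printing Implicit Defensive.

Import Order.TTheory GRing.Theory Num.Theory.

Local Open Scope fset_scope.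
Local Open Scope classical_set_scope.
Local Open Scope ring_scope.

(** * Countable index types *)

(** An enumeration by [nat] with holes, so that a union over [I] is literally a
    union over [nat]; an empty [I] is allowed. *)
Definition enumerable (I : Type) := exists f : nat -> option I, forall i, exists n, f n = Some i.

Lemma enumerable_nat : enumerable nat.
Proof. by exists some => i; exists i. Qed.

Lemma enumerable_surj (I J : Type) (g : I -> option J) :
  (forall j, exists i, g i = Some j) -> enumerable I -> enumerable J.
Proof.
move=> gP [f fP]; exists (fun n => obind g (f n)) => j.
by have [i gi] := gP j; have [n fn] := fP i; exists n; rewrite fn.
Qed.

Lemma enumerable_seq (I : Type) : enumerable I -> enumerable (seq I).
Proof.
move=> [f fP]; exists (fun n => omap (pmap f) (choice.unpickle n : option (seq nat))) => s.
have [t ts] : exists t, pmap f t = s.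
  elim: s => [|i s [t <-]]; first by exists [::].
  by have [n fn] := fP i; exists (n :: t); rewrite /= fn.
by exists (choice.pickle t); rewrite choice.pickleK /= ts.
Qed.

Lemma enumerable_fset (I : choiceType) : enumerable I -> enumerable {fset I}.
Proof.
move=> /enumerable_seq; apply: enumerable_surj (fun s => Some [fset x in s]) _ => A.
by exists (enum_fset A); congr Some; apply/fsetP => x; rewrite !inE.
Qed.

Lemma enumerable_prod (I J : Type) : enumerable I -> enumerable J -> enumerable (I * J).
Proof.
move=> [f fP] [g gP].
exists (fun n => if (choice.unpickle n : option (nat * nat)) is Some (a, b)
          then if f a is Some i then if g b is Some j then Some (i, j) else None
               else None else None) => -[i j].
have [a fa] := fP i; have [b gb] := gP j.
by exists (choice.pickle (a, b)); rewrite choice.pickleK fa gb.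
Qed.

Lemma countable_enumerable (T : Type) : countable [set: T] -> enumerable T.
Proof.
move=> /pcard_leP[f].
exists (fun n => if pselect (exists x, f x = n) is left h then Some (projT1 (cid h)) else None).
move=> x; exists (f x); case: pselect => [h|[]]; last by exists x.
by congr Some; case: cid => y /= /inj -> //; rewrite inE.
Qed.

Section Measurability.
Context d (T : measurableType d).
Implicit Types (Q : T -> Prop).

Lemma measurable_exists (I : Type) (Q : I -> T -> Prop) : enumerable I ->
  (forall i, measurable [set w | Q i w]) -> measurable [set w | exists i, Q i w].
Proof.
move=> [f fP] mQ.
have -> : [set w | exists i, Q i w] =
    \bigcup_n (if f n is Some i then [set w | Q i w] else set0).
  apply/seteqP; split=> w /=.
    by move=> [i Qi]; have [n fn] := fP i; exists n => //; rewrite fn.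
  by move=> [n _]; case: (f n) => // i Qi; exists i.
by apply: bigcupT_measurable => n; case: (f n).
Qed.

Lemma measurable_not Q : measurable [set w | Q w] -> measurable [set w | ~ Q w].
Proof. by move=> /measurableC; congr measurable. Qed.

Lemma measurable_and Q Q' : measurable [set w | Q w] -> measurable [set w | Q' w] ->
  measurable [set w | Q w /\ Q' w].
Proof. exact: measurableI. Qed.

Lemma measurable_or Q Q' : measurable [set w | Q w] -> measurable [set w | Q' w] ->
  measurable [set w | Q w \/ Q' w].
Proof. exact: measurableU. Qed.

Lemma measurable_Prop (Q : Prop) : measurable [set _ : T | Q].
Proof.
have [q|nq] := pselect Q.
  by have -> : [set _ : T | Q] = setT by apply/seteqP; split.
by have -> : [set _ : T | Q] = set0 by apply/seteqP; split.
Qed.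

Lemma measurable_imply Q Q' : measurable [set w | Q w] -> measurable [set w | Q' w] ->
  measurable [set w | Q w -> Q' w].
Proof.
move=> mQ mQ'; have -> : [set w | Q w -> Q' w] = [set w | ~ Q w \/ Q' w].
  apply/seteqP; split => w /=; last by case=> // nq /nq.
  by move=> qq; have [/qq|] := pselect (Q w); [right|left].
by apply: measurable_or => //; exact: measurable_not.
Qed.

Lemma measurable_forall (I : Type) (Q : I -> T -> Prop) : enumerable I ->
  (forall i, measurable [set w | Q i w]) -> measurable [set w | forall i, Q i w].
Proof.
move=> eI mQ; have -> : [set w | forall i, Q i w] = [set w | ~ exists i, ~ Q i w].
  apply/seteqP; split => w /= h; first by move=> [i]; apply.
  by move=> i; apply: contrapT => nq; apply: h; exists i.
by apply: measurable_not; apply: measurable_exists => // i; exact: measurable_not.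
Qed.

End Measurability.

(** * Real-valued probabilities *)

Section RealProbability.
Context d (T : measurableType d) (R : realType).
Implicit Types (mu : probability T R) (A B : set T).

Definition Pr mu A : R := fine (mu A).

Lemma PrE mu A : measurable A -> mu A = (Pr mu A)%:E.
Proof. by move=> mA; rewrite /Pr fineK// fin_num_measure. Qed.

Lemma Pr_ge0 mu A : 0 <= Pr mu A.
Proof. by rewrite /Pr fine_ge0. Qed.

Lemma Pr_setT mu : Pr mu setT = 1.
Proof. by rewrite /Pr probability_setT. Qed.

Lemma Pr_set0 mu : Pr mu set0 = 0.
Proof. by rewrite /Pr measure0. Qed.

Lemma le_Pr mu A B : measurable A -> measurable B -> A `<=` B -> Pr mu A <= Pr mu B.
Proof.
by move=> mA mB AB; rewrite -lee_fin -!PrE// le_measure// inE.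
Qed.

Lemma Pr_le1 mu A : measurable A -> Pr mu A <= 1.
Proof. by move=> mA; rewrite -(Pr_setT mu); exact: le_Pr. Qed.

Lemma Pr_setC mu A : measurable A -> Pr mu (~` A) = 1 - Pr mu A.
Proof.
move=> mA; apply: EFin_inj; rewrite -PrE; last exact: measurableC.
by rewrite probability_setC// PrE.
Qed.

Lemma Pr_setU_le mu A B : measurable A -> measurable B ->
  Pr mu (A `|` B) <= Pr mu A + Pr mu B.
Proof.
move=> mA mB; rewrite -lee_fin EFinD -!PrE//; last exact: measurableU.
exact: measureU2.
Qed.

Lemma Pr_bigU_le mu (I : choiceType) (s : seq I) (F : I -> set T) A :
  measurable A -> (forall i, measurable (F i)) ->
  (forall w, A w -> exists2 i, i \in s & F i w) ->
  Pr mu A <= \sum_(i <- s) Pr mu (F i).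
Proof.
move=> mA mF AF.
have mU (r : seq I) : measurable (\big[setU/set0]_(i <- r) F i).
  by apply: bigsetU_measurable => i _.
apply: (@le_trans _ _ (Pr mu (\big[setU/set0]_(i <- s) F i))).
  by apply: le_Pr => // w /AF[i si Fi]; rewrite -bigcup_seq; exists i.
elim: s {AF} => [|i s IH]; first by rewrite !big_nil Pr_set0.
by rewrite !big_cons (le_trans (Pr_setU_le _ _ _))// lerD2l.
Qed.

Lemma Pr_partition mu (I : choiceType) (J : {fset I}) (N : T -> I) A :
  measurable A -> (forall i, measurable [set w | N w = i]) ->
  (forall w, N w \in J) ->
  Pr mu A = \sum_(i <- J) Pr mu (A `&` [set w | N w = i]).
Proof.
move=> mA mN NJ; apply: EFin_inj; rewrite -PrE// -sumEFin.
have mF i : measurable (A `&` [set w | N w = i]) by exact: measurableI.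
under eq_bigr do rewrite -PrE//.
rewrite -measure_fbigsetU//; last first.
  by move=> i j _ _ [w [[_ /= <-] [_ /= <-]]].
congr (mu _); rewrite -bigcup_seq; apply/seteqP; split=> w /=.
  by move=> Aw; exists (N w) => //=; exact: NJ.
by move=> [i _ []].
Qed.

Lemma Pr_bigcup_le mu (F : nat -> set T) A a :
  measurable A -> (forall n, measurable (F n)) -> A `<=` \bigcup_n F n ->
  (forall n, \sum_(i < n) Pr mu (F i) <= a) -> Pr mu A <= a.
Proof.
move=> mA mF AF Fa; rewrite -lee_fin -PrE//.
apply: le_trans (measure_sigma_subadditive mu mF mA AF) _.
apply: lime_le; first exact: is_cvg_ereal_nneg_natsum.
apply: nearW => n; rewrite big_mkord (eq_bigr _ (fun (i : ordinal n) _ => PrE mu (mF i))).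
by rewrite sumEFin lee_fin; exact: Fa.
Qed.

(** Countable subadditivity for the [X i] and countable additivity for the disjoint
    [Y i]. *)
Lemma Pr_disjoint_domination mu (I : eqType) (X Y : I -> set T) A Z a :
  enumerable I -> 0 <= a -> measurable A -> measurable Z ->
  (forall i, measurable (X i)) -> (forall i, measurable (Y i)) ->
  (forall i j w, Y i w -> Y j w -> i = j) ->
  (forall i, Y i `<=` Z) -> (forall w, A w -> exists i, X i w) ->
  (forall i, Pr mu (X i) <= a * Pr mu (Y i)) -> Pr mu A <= a * Pr mu Z.
Proof.
move=> [f fP] a0 mA mZ mX mY Yinj YZ AX XY.
(* only the first occurrence of an index in the enumeration counts *)
pose first n := all (fun m => f m != f n) (iota 0 n).
pose sel (W : I -> set T) n := if f n is Some i then if first n then W i else set0 else set0.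
have msel W n : (forall i, measurable (W i)) -> measurable (sel W n).
  by rewrite /sel; case: (f n) => // i mW; case: ifP.
apply: (@Pr_bigcup_le _ (sel X)) => //.
- by move=> n; exact: msel.
- move=> w /AX[i Xi]; have [k fk] := fP i.
  have ex : exists n, f n == Some i by exists k; rewrite fk.
  exists (ex_minn ex) => //; case: ex_minnP => n /eqP fn nmin.
  rewrite /sel fn; suff -> : first n by [].
  apply/allP => m; rewrite mem_iota add0n => /andP[_ mn]; apply/negP.
  by rewrite fn => /nmin; rewrite leqNgt mn.
move=> n; apply: (@le_trans _ _ (a * \sum_(i < n) Pr mu (sel Y i))).
  rewrite mulr_sumr; apply: ler_sum => i _; rewrite /sel.
  by case: (f i) => [j|]; [case: ifP|]; rewrite ?Pr_set0 ?mulr0.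
apply: ler_wpM2l => //; rewrite -lee_fin -PrE// -sumEFin.
have mselY m : measurable (sel Y m) by exact: msel.
have selYinj : trivIset setT (sel Y).
  move=> m k _ _ [w []]; rewrite /sel.
  case fm: (f m) => [i|//]; case: ifP => // fim Yi.
  case fk: (f k) => [j|//]; case: ifP => // fik Yj.
  have ij := Yinj _ _ _ Yi Yj; subst j.
  have [mk|km|//] := ltngtP m k.
    by move/allP: fik => /(_ m); rewrite mem_iota add0n mk fm fk eqxx => /(_ isT).
  by move/allP: fim => /(_ k); rewrite mem_iota add0n km fm fk eqxx => /(_ isT).
rewrite (eq_bigr (fun i : 'I_n => mu (sel Y i))); last by move=> i _; rewrite -PrE.
rewrite -(measure_bigsetU mu mselY selYinj n) le_measure// ?inE//.
  by apply: bigsetU_measurable => i _; exact: msel.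
move=> w; rewrite -bigcup_mkord => -[i _]; rewrite /sel.
by case: (f i) => // j; case: ifP => // _ /YZ.
Qed.

(** Expectation of a pointwise comparison between two numbers of occurring events. *)
Lemma Pr_sum_indic_le mu (I J : Type) (r : seq I) (s : seq J)
    (F : I -> set T) (H : J -> set T) (c : R) :
  0 <= c -> (forall i, measurable (F i)) -> (forall j, measurable (H j)) ->
  (forall w, c * \sum_(j <- s) \1_(H j) w <= \sum_(i <- r) \1_(F i) w) ->
  c * \sum_(j <- s) Pr mu (H j) <= \sum_(i <- r) Pr mu (F i).
Proof.
move=> c0 mF mH cHF.
have intE (K : Type) (t : seq K) (E : K -> set T) : (forall k, measurable (E k)) ->
    (\int[mu]_w (\sum_(k <- t) \1_(E k) w)%:E = (\sum_(k <- t) Pr mu (E k))%:E)%E.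
  move=> mE; under eq_integral do rewrite -sumEFin.
  rewrite ge0_integral_sum//.
  - rewrite -sumEFin; apply: eq_bigr => k _; rewrite integral_indic// ?setIT.
    by rewrite /Pr fineK// fin_num_measure.
  - by move=> k; apply/measurable_EFinP; exact: measurable_indic.
have mS (K : Type) (t : seq K) (E : K -> set T) : (forall k, measurable (E k)) ->
    measurable_fun setT (fun w => (\sum_(k <- t) \1_(E k) w)%:E : \bar R).
  move=> mE; apply/measurable_EFinP; apply: measurable_sum => k.
  exact: measurable_indic.
have S0 (K : Type) (t : seq K) (E : K -> set T) w : 0 <= \sum_(k <- t) \1_(E k) w :> R.
  by apply: sumr_ge0 => k _.
rewrite -lee_fin EFinM -!intE// -ge0_integralZl//.
- apply: ge0_le_integral => //.
  + by move=> w _; rewrite -EFinM lee_fin mulr_ge0.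
  + by apply: measurable_funeM; exact: mS.
  + exact: mS.
  + by move=> w _; rewrite -EFinM lee_fin.
- exact: mS.
- by move=> w _; rewrite lee_fin.
Qed.

Lemma Pr_bigcup_gt mu (F : nat -> set T) a :
  (forall n, measurable (F n)) -> (forall m n, (m <= n)%N -> F m `<=` F n) ->
  a < Pr mu (\bigcup_n F n) -> exists n, a < Pr mu (F n).
Proof.
move=> mF ndF aF; apply: contrapT => nF.
suff : Pr mu (\bigcup_n F n) <= a by rewrite leNgt aF.
have mU : measurable (\bigcup_n F n) by exact: bigcupT_measurable.
rewrite -lee_fin -PrE//.
have cvg := @nondecreasing_cvg_mu _ _ _ mu F mF mU.
have /cvg{}cvg : nondecreasing_seq F by move=> m n mn; apply/subsetPset; exact: ndF.
rewrite -(cvg_lim _ cvg)//; apply: lime_le; first by apply/cvg_ex; eexists; exact: cvg.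
apply: nearW => n /=; rewrite PrE// lee_fin leNgt; apply/negP => an.
by apply: nF; exists n.
Qed.

End RealProbability.

Section Product.
Context d1 d2 (T1 : measurableType d1) (T2 : measurableType d2) (R : realType).
Variables (P1 : probability T1 R) (P2 : probability T2 R).
Implicit Types X Y : set (T1 * T2).

Lemma Pr_prodE (A : set T1) (B : set T2) : measurable A -> measurable B ->
  Pr (P1 \x P2)%E (A `*` B) = Pr P1 A * Pr P2 B.
Proof.
move=> mA mB; apply: EFin_inj; rewrite -PrE; last exact: measurableX.
apply: etrans (product_measure1E P1 P2 mA mB) _.
by rewrite EFinM -!PrE.
Qed.

(** Fubini for sets. Stating it as a comparison of fibres lets conditioning on one
    factor be done without mentioning integrals. *)
Lemma le_Pr_prod_fibre1 X Y (a b : R) : 0 <= a -> 0 <= b -> measurable X -> measurable Y ->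
  (forall x, b * Pr P2 [set y | X (x, y)] <= a * Pr P2 [set y | Y (x, y)]) ->
  b * Pr (P1 \x P2)%E X <= a * Pr (P1 \x P2)%E Y.
Proof.
move=> a0 b0 mX mY XY; rewrite -lee_fin !EFinM -!PrE//.
rewrite /product_measure1 -!ge0_integralZl//; try exact: measurable_fun_xsection.
apply: ge0_le_integral => //.
- by move=> x _; rewrite mule_ge0.
- by apply: measurable_funeM; exact: measurable_fun_xsection.
- by apply: measurable_funeM; exact: measurable_fun_xsection.
move=> x _ /=; rewrite !PrE; try exact: measurable_xsection.
by rewrite -!EFinM lee_fin !xsectionE; exact: XY.
Qed.

Lemma le_Pr_prod_fibre2 X Y (a b : R) : 0 <= a -> 0 <= b -> measurable X -> measurable Y ->
  (forall y, b * Pr P1 [set x | X (x, y)] <= a * Pr P1 [set x | Y (x, y)]) ->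
  b * Pr (P1 \x P2)%E X <= a * Pr (P1 \x P2)%E Y.
Proof.
move=> a0 b0 mX mY XY; rewrite -lee_fin !EFinM.
have sw Z : measurable Z -> ((Pr (P1 \x P2)%E Z)%:E = (P1 \x^ P2) Z)%E.
  move=> mZ; rewrite -PrE//; apply: product_measure_unique => // A B mA mB.
  exact: product_measure2E.
rewrite !sw// /product_measure2 -!ge0_integralZl//; try exact: measurable_fun_ysection.
apply: ge0_le_integral => //.
- by move=> x _; rewrite mule_ge0.
- by apply: measurable_funeM; exact: measurable_fun_ysection.
- by apply: measurable_funeM; exact: measurable_fun_ysection.
move=> x _ /=; rewrite !PrE; try exact: measurable_ysection.
by rewrite -!EFinM lee_fin !ysectionE; exact: XY.
Qed.

End Product.

(** Jensen's inequality for [expR] and the number [#|N|] of events that occur,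
    proved by bounding [expR] from below by its tangent at the mean [a * m]. *)
Lemma expR_sum_Pr_le d (T : measurableType d) (R : realType) (mu : probability T R)
    (I : choiceType) (D : {fset I}) (E : I -> set T) (N : T -> {fset I}) (a : R) :
  (forall i, measurable (E i)) -> (forall B, measurable [set w | N w = B]) ->
  (forall w i, i \in N w <-> i \in D /\ E i w) ->
  expR (a * \sum_(i <- D) Pr mu (E i)) <=
    \sum_(B <- fpowerset D) Pr mu [set w | N w = B] * expR (a * #|` B|%:R).
Proof.
move=> mE mN NP; set m := \sum_(i <- D) _.
have ND w : N w \in fpowerset D by rewrite fpowersetE; apply/fsubsetP => i /NP[].
pose pB B := Pr mu [set w | N w = B].
have sum1 : \sum_(B <- fpowerset D) pB B = 1.
  rewrite -(Pr_setT mu) (Pr_partition mu measurableT mN ND).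
  by apply: eq_bigr => B _; rewrite setTI.
have summ : \sum_(B <- fpowerset D) pB B * #|` B|%:R = m.
  transitivity (\sum_(B <- fpowerset D) \sum_(i <- D) pB B * (i \in B)%:R).
    apply: eq_big_seq => B; rewrite fpowersetE => BD; rewrite -mulr_sumr; congr (_ * _).
    rewrite -natr_sum; congr _%:R.
    rewrite -big_mkcond/= big_fset_condE/= sum1_size; congr size.
    by congr enum_fset; apply/fsetP => i; rewrite !inE/= andb_idl// => /(fsubsetP BD).
  rewrite exchange_big/=; apply: eq_big_seq => i iD.
  rewrite (Pr_partition mu (mE i) mN ND); apply: eq_bigr => B _.
  case: (boolP (i \in B)) => iB; rewrite ?mulr1 ?mulr0.
    congr Pr; apply/seteqP; split=> w /=; last by case.
    by move=> NB; split=> //; move: iB; rewrite -NB => /NP[].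
  apply/esym; rewrite -(Pr_set0 mu); congr Pr; apply/seteqP; split=> w //= [Ew NB].
  by move/negP: iB; apply; rewrite -NB; apply/NP.
apply: (@le_trans _ _ (\sum_(B <- fpowerset D)
    pB B * (expR (a * m) * (1 + (a * #|` B|%:R - a * m))))); last first.
  apply: ler_sum => B _; rewrite ler_wpM2l ?Pr_ge0//.
  set x := a * #|` B|%:R; have -> : expR x = expR (a * m) * expR (x - a * m).
    by rewrite -expRD; congr expR; ring.
  by rewrite ler_wpM2l ?expR_ge0// expR_ge1Dx.
rewrite (eq_bigr (fun B => expR (a * m) * (1 - a * m) * pB B +
    expR (a * m) * a * (pB B * #|` B|%:R))); last by move=> B _; ring.
by rewrite big_split/= -!mulr_sumr sum1 summ le_eqVlt -subr_eq0; apply/orP; left; apply/eqP; ring.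
Qed.

(** * Bernoulli measures on edge configurations *)

Section Configurations.
Variables (V : choiceType) (G : graph V).
Local Notation edge := (edge G).
Local Notation config := (config G).

Definition closed_on (A : {fset edge}) : set config :=
  [set w | forall e, e \in A -> w e = false].

Lemma measurable_edge (e : edge) (b : bool) : measurable [set w : config | w e = b].
Proof. by apply: sub_sigma_algebra; exists e, b. Qed.

Lemma measurable_edge_true (e : edge) : measurable [set w : config | w e].
Proof. exact: measurable_edge. Qed.

Lemma measurable_closed_on A : measurable (closed_on A).
Proof.
have -> : closed_on A = \bigcap_(e in [set` A]) [set w | w e = false].
  by apply/seteqP; split.
apply: fin_bigcap_measurable => [|e _]; first exact: finite_fset.
exact: measurable_edge.
Qed.

Lemma measurable_to_config d (T : measurableType d) (f : T -> config) :
  (forall e, measurable [set t | f t e]) -> measurable_fun setT f.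
Proof.
move=> mf; apply: (@measurability _ _ T config setT f (@edge_events V G)) => //.
move=> _ [_ [e [b ->]] <-]; rewrite setTI.
have mE : measurable [set t | f t e] by [].
case: b; first by [].
have -> : f @^-1` [set w | w e = false] = ~` [set t | f t e].
  by apply/seteqP; split=> t /=; [move=> ->|move/negP/negbTE].
exact: measurableC.
Qed.

Lemma config_sigma_algebra : (@measurable _ config) = <<s range closed_on >>.
Proof.
apply/seteqP; split; last first.
  apply: smallest_sub; first by split=> [|X mX|F mF];
    [exact: measurable0|exact: measurableD|exact: bigcupT_measurable].
  by move=> _ [A _ <-]; exact: measurable_closed_on.
apply: smallest_sub; first exact: smallest_sigma_algebra.
have c1 e : <<s range closed_on >> [set w | w e = false].
  apply: sub_sigma_algebra; exists [fset e] => //.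
  apply/seteqP; split=> w /=; first by apply; rewrite inE.
  by move=> we e'; rewrite inE => /eqP ->.
move=> _ [e [[] ->]] //.
have -> : [set w | w e = true] = setT `\` [set w : config | w e = false].
  by apply/seteqP; split=> w /=; [move=> ->|case=> _; case: (w e)].
exact: sigma_algebraCD.
Qed.

Variable R : realType.
Implicit Types mu nu : probability config R.

(** Enough to characterise the law, see below; as these events are products in any
    splitting of the edges, they are easy to follow under the maps used here. *)
Definition product_law (p : R) mu :=
  forall A, Pr mu (closed_on A) = (1 - p) ^+ #|` A|.

Lemma bernoulli_product_law p mu : bernoulli_percolation p mu -> product_law p mu.
Proof.
move=> /[swap] A /(_ A (fun=> false)) /= E; rewrite /Pr [closed_on A]/closed_on E/=.
by rewrite big_const_seq count_predT iter_mulr_1 .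
Qed.

(** The events that finitely many given edges are closed form a pi-system, so
    they determine the law; matching their probabilities identifies the image
    of a measure under any map into configurations. *)
Lemma Pr_preimage_product_law d (T : measurableType d) (nu : probability T R)
    (f : T -> config) p mu : product_law p mu ->
  (forall e, measurable [set t | f t e]) ->
  (forall A, Pr nu (f @^-1` closed_on A) = (1 - p) ^+ #|` A|) ->
  forall X, measurable X -> Pr nu (f @^-1` X) = Pr mu X.
Proof.
move=> pmu /measurable_to_config mf pnu X mX; rewrite /Pr; congr fine.
have mpre Y : measurable Y -> measurable (f @^-1` Y).
  by move=> mY; rewrite -[X in measurable X]setTI; exact: mf.
have cT : closed_on fset0 = setT by apply/seteqP; split.
suff : pushforward nu f X = mu X by [].
unshelve apply: (@measure_unique _ _ _ (range closed_on) (fun=> setT) _ _ _ _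
  (@measure_function_pushforward__canonical__measure_function_Measure _ _ _ _ _ nu f mf) mu) => //.
- exact: config_sigma_algebra.
- move=> _ _ [A _ <-] [B _ <-]; exists (A `|` B)%fset => //.
  apply/seteqP; split=> w /=.
    by move=> h; split=> e eA; apply: h; rewrite inE eA ?orbT.
  by move=> [hA hB] e; rewrite inE => /orP[/hA|/hB].
- by move=> _; exists fset0.
- by rewrite bigcup_const//; exists 0%N.
- move=> _ [A _ <-] /=; rewrite /pushforward.
  have mA := measurable_closed_on A.
  rewrite (PrE mu mA) (PrE nu (mpre _ mA)) pmu pnu//.
- by move=> _ /=; rewrite /pushforward preimage_setT probability_setT ltry.
Qed.

Definition determined_by (F : set edge) (X : set config) :=
  forall w w' : config, (forall e, F e -> w e = w' e) -> X w -> X w'.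

(** Resampling the edges outside [F] from an independent copy preserves a
    product law, and it decouples events that look at complementary edges. *)
Lemma Pr_independent p mu (F : set edge) (X Y : set config) : product_law p mu ->
  measurable X -> measurable Y -> determined_by F X -> determined_by (~` F) Y ->
  Pr mu (X `&` Y) = Pr mu X * Pr mu Y.
Proof.
move=> pmu mX mY XF YF.
pose splice (w : config * config) : config := fun e => if `[< F e >] then w.1 e else w.2 e.
rewrite -(@Pr_preimage_product_law _ _ (mu \x mu)%E splice p); last exact: measurableI.
- rewrite -Pr_prodE//; congr Pr; apply/seteqP; split=> -[w1 w2] [/= Xw Yw]; split => /=.
  + by apply: XF Xw => e Fe; rewrite /splice asboolT.
  + by apply: YF Yw => e Fe; rewrite /splice asboolF.
  + by apply: XF Xw => e Fe; rewrite /splice asboolT.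
  + by apply: YF Yw => e Fe; rewrite /splice asboolF.
- exact: pmu.
- move=> e; rewrite /splice; case: asboolP => Fe.
    have := measurable_edge_true e => /measurableX/(_ measurableT).
    by move=> /(_ _ config); congr measurable; apply/seteqP; split=> w //= [].
  have := @measurableX _ _ config _ _ _ measurableT (measurable_edge_true e).
  by congr measurable; apply/seteqP; split=> w //= [].
- move=> A; pose A1 := [fset e in A | `[< F e >]]; pose A2 := [fset e in A | ~~ `[< F e >]].
  have -> : splice @^-1` closed_on A = closed_on A1 `*` closed_on A2.
    apply/seteqP; split=> -[w1 w2] /=.
      move=> h; split=> e; rewrite !inE => /andP[/h]; rewrite /splice/=.
        by move=> + eF; rewrite eF.
      by move=> + /negbTE eF; rewrite eF.
    move=> [h1 h2] e eA; rewrite /splice/=; case: ifPn => Fe; [apply: h1|apply: h2];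
      by rewrite !inE eA.
  rewrite Pr_prodE; [|exact: measurable_closed_on..].
  rewrite !pmu -exprD; congr (_ ^+ _).
  rewrite -(cardfsID A1 A) ; congr (_ + _)%N.
    by congr #|` _|; apply/fsetP => e; rewrite !inE; case: (e \in A).
  by congr #|` _|; apply/fsetP => e; rewrite !inE; case: (e \in A) => //=; rewrite andbT.
Qed.

Definition join_config (w : config * config) : config := fun e => w.1 e || w.2 e.

Lemma measurable_join_config (e : edge) : measurable [set w | join_config w e].
Proof.
have -> : [set w | join_config w e] =
    ([set w : config | w e] `*` [set: config]) `|` ([set: config] `*` [set w : config | w e]).
  apply/seteqP; split=> -[w1 w2] /=; first by case/orP; [left|right].
  by move=> [[wE _]|[_ wE]]; rewrite /join_config/= wE ?orbT.
by apply: measurableU; apply: measurableX => //; exact: measurable_edge_true.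
Qed.

(** An edge is closed in the union of two independent configurations exactly when
    it is closed in both. *)
Lemma Pr_sprinkle p q r mu nu rho : product_law p mu -> product_law q nu -> product_law r rho ->
  1 - r = (1 - p) * (1 - q) ->
  forall X, measurable X -> Pr (mu \x nu)%E (join_config @^-1` X) = Pr rho X.
Proof.
move=> pmu qnu rrho rpq; apply: (Pr_preimage_product_law rrho).
  exact: measurable_join_config.
move=> A; have -> : join_config @^-1` closed_on A = closed_on A `*` closed_on A.
  apply/seteqP; split=> -[w1 w2] /=; last first.
    by move=> [h1 h2] e eA; rewrite /join_config/= h1// h2.
  by move=> h; split=> e /h/negbT; rewrite /join_config/= negb_or => /andP[/negbTE ? /negbTE].
by rewrite Pr_prodE; [rewrite pmu qnu rpq exprMn|exact: measurable_closed_on..].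
Qed.

Definition increasing_event (X : set config) :=
  forall w w' : config, (forall e, w e -> w' e) -> X w -> X w'.

(** The sprinkling couples the parameters [p <= r] monotonically. *)
Lemma Pr_increasing p q r mu nu rho X : product_law p mu -> product_law q nu -> product_law r rho ->
  1 - r = (1 - p) * (1 - q) -> measurable X -> increasing_event X -> Pr mu X <= Pr rho X.
Proof.
move=> pmu qnu rrho rpq mX iX; rewrite -(Pr_sprinkle pmu qnu rrho rpq mX).
rewrite -[leLHS]mulr1 -(Pr_setT nu) -Pr_prodE//; apply: le_Pr.
- exact: measurableX.
- rewrite -[X in measurable X]setTI; apply: measurable_to_config => //.
  exact: measurable_join_config.
- by move=> [w1 w2] [/= Xw _]; apply: iX Xw => e; rewrite /join_config/= => ->.
Qed.

End Configurations.

(** * Connection off a set, and rays *)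

Section Reach.
Variable V : choiceType.
Implicit Types (H : graph V) (J : set V) (x y u v : V).

(** The path must avoid [J] at its initial vertex as well, so the set is empty when
    [x] lies in [J]. *)
Definition reach_off H J x : set V :=
  [set u | exists2 s : seq V, path (adj H) x s &
    last x s = u /\ forall y, y \in x :: s -> ~ J y].

Lemma reach_off_notin H J x u : reach_off H J x u -> ~ J x /\ ~ J u.
Proof.
by move=> [s _ [<- sJ]]; split; apply: sJ; [exact: mem_head|exact: mem_last].
Qed.

Lemma reach_off_refl H J x : ~ J x -> reach_off H J x x.
Proof. by move=> nJ; exists [::] => //; split => // y; rewrite inE => /eqP ->. Qed.

Lemma reach_off_step H J x u v :
  reach_off H J x u -> adj H u v -> ~ J v -> reach_off H J x v.
Proof.
move=> [s xs [su sJ]] uv nJ; exists (rcons s v); first by rewrite rcons_path xs su.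
split; first by rewrite last_rcons.
by move=> y; rewrite -rcons_cons mem_rcons inE => /predU1P[->|/sJ].
Qed.

Lemma reach_off_ind H J x (X : set V) : X x ->
  (forall u v, X u -> ~ J u -> adj H u v -> ~ J v -> X v) -> reach_off H J x `<=` X.
Proof.
move=> Xx XS u [s xs [<- sJ]]; elim: s x Xx xs sJ => //= y s IH x Xx /andP[xy ys] sJ.
have Jx : ~ J x by apply: sJ; exact: mem_head.
have Jy : ~ J y by apply: sJ; rewrite !inE eqxx orbT.
apply: IH => //; first exact: XS Xx Jx xy Jy.
by move=> z zs; apply: sJ; rewrite inE zs orbT.
Qed.

Lemma reach_off_trans H J x y u : reach_off H J x y -> reach_off H J y u -> reach_off H J x u.
Proof. by move=> xy; apply: reach_off_ind => // a b xa _; exact: reach_off_step. Qed.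

Lemma reach_off_sym H J x u : reach_off H J x u -> reach_off H J u x.
Proof.
move=> xu; have [Jx Ju] := reach_off_notin xu.
suff : reach_off H J x `<=` (fun u => reach_off H J u x) by exact.
apply: reach_off_ind => [|a b ax Ja ab Jb]; first exact: reach_off_refl.
by apply: reach_off_trans ax; apply: (reach_off_step (reach_off_refl _ Jb)) => //; rewrite adj_sym.
Qed.

Lemma reach_off_sub H H' J J' x : (forall u v, ~ J u -> ~ J v -> adj H u v -> adj H' u v) ->
  J' `<=` J -> reach_off H J x `<=` reach_off H' J' x.
Proof.
move=> HH' JJ' u xu; have [Jx _] := reach_off_notin xu.
move: u xu; apply: reach_off_ind => [|a b xa Ja ab Jb].
  by apply: reach_off_refl => J'x; exact/Jx/JJ'.
by apply: (reach_off_step xa); [exact: HH'|move=> J'b; exact/Jb/JJ'].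
Qed.

Lemma componentE H x : component H x = reach_off H set0 x.
Proof.
apply/seteqP; split=> u.
  by move=> [s xs <-]; exists s => //; split => // y _ [].
by move=> [s xs [<- _]]; exists s.
Qed.

Lemma infinite_reach_off_eq H J x y : reach_off H J x y ->
  infinite_set (reach_off H J x) -> infinite_set (reach_off H J y).
Proof.
move=> xy ix; apply: sub_infinite_set ix => u xu.
by apply: reach_off_trans xu; exact: reach_off_sym.
Qed.

(** A self-avoiding path to [u] never returns to its first vertex, so that [x] can be
    removed once its second vertex [y] is reached. *)
Lemma reach_off_first H J x u : reach_off H J x u ->
  u = x \/ exists y, [/\ adj H x y, ~ (J `|` [set x]) y & reach_off H (J `|` [set x]) y u].
Proof.
move=> [s xs [su sJ]]; case: (shortenP xs) su => s' xs' us' s's su.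
have {}sJ y : y \in x :: s' -> ~ J y.
  by rewrite inE => /predU1P[->|/s's ys]; apply: sJ; rewrite inE ?eqxx ?ys ?orbT.
case: s' xs' us' s's su sJ => [|y s'] /=; first by move=> _ _ _ <-; left.
move=> /andP[xy ys'] /andP[xys' _] _ su sJ; right; exists y.
have nJ z : z \in y :: s' -> ~ (J `|` [set x]) z.
  move=> zs [|/= zx]; first by apply: sJ; rewrite inE zs orbT.
  by move: xys'; rewrite -zx zs.
by split=> //; [apply: nJ; exact: mem_head|exists s'].
Qed.

(** König's lemma: a vertex that reaches infinitely many others has, by the previous
    lemma and local finiteness, a neighbour that reaches infinitely many without
    coming back. The states of the recursion record the vertices visited so far, so
    that the ray is injective. *)
Lemma infinite_reach_off_ray H J x : locally_finite H -> infinite_set (reach_off H J x) ->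
  exists f : nat -> V, [/\ injective f, f 0%N = x, forall n, ~ J (f n)
    & forall n, adj H (f n) (f n.+1)].
Proof.
move=> lfH xinf.
pose St := {Jx : set V * V | infinite_set (reach_off H Jx.1 Jx.2)}.
have next (a : St) : exists b : St, (projT1 b).1 = (projT1 a).1 `|` [set (projT1 a).2]
    /\ adj H (projT1 a).2 (projT1 b).2.
  case: a => -[/= K y] yinf; apply: contrapT => nb; apply: yinf.
  apply: (@sub_finite_set _ _ ([set y] `|`
    \bigcup_(z in neighbours H y `&` ~` (K `|` [set y])) reach_off H (K `|` [set y]) z)).
    move=> u /reach_off_first[->|[z [yz Kz zu]]]; first by left.
    by right; exists z.
  rewrite finite_setU; split => //; apply: bigcup_finite.
    by apply: sub_finite_set (lfH y) => z [].
  move=> z [yz Kz]; apply: contrapT => zinf; apply: nb.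
  by exists (exist _ (K `|` [set y], z) zinf).
pose nxt a := projT1 (cid (next a)).
have nxtE (a : St) : (projT1 (nxt a)).1 = (projT1 a).1 `|` [set (projT1 a).2] by rewrite /nxt; case: cid => ? [].
have nxtA (a : St) : adj H (projT1 a).2 (projT1 (nxt a)).2 by rewrite /nxt; case: cid => ? [].
pose g n := iter n nxt (exist _ (J, x) xinf : St).
pose f n := (projT1 (g n)).2.
have gJ n : J `<=` (projT1 (g n)).1.
  by elim: n => //= n IH u Ju; rewrite nxtE; left; exact: IH.
have gin m n : (m < n)%N -> (projT1 (g n)).1 (f m).
  elim: n => // n IH; rewrite ltnS leq_eqVlt /= nxtE => /predU1P[->|/IH]; first by right.
  by left.
have gnotin n : ~ (projT1 (g n)).1 (f n).
  move=> h; have := proj2_sig (g n); apply.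
  apply: (@sub_finite_set _ _ set0) => // u ru.
  by have [nf _] := reach_off_notin ru; exact: nf h.
exists f; split => //.
- move=> m n fmn; have [mn|nm|//] := ltngtP m n.
    by have := gnotin n; rewrite -fmn; have := gin _ _ mn.
  by have := gnotin m; rewrite fmn; have := gin _ _ nm.
- by move=> n Jf; apply: (gnotin n); exact: gJ.
- by move=> n; exact: nxtA.
Qed.

Lemma ray_reach_off H J (f : nat -> V) : (forall n, ~ J (f n)) ->
  (forall n, adj H (f n) (f n.+1)) -> forall n, reach_off H J (f 0%N) (f n).
Proof.
by move=> fJ fH; elim=> [|n IH]; [exact: reach_off_refl|exact: reach_off_step IH _ _].
Qed.

Lemma ray_infinite_reach_off H J (f : nat -> V) : injective f -> (forall n, ~ J (f n)) ->
  (forall n, adj H (f n) (f n.+1)) -> infinite_set (reach_off H J (f 0%N)).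
Proof.
move=> finj fJ fH; apply: (@sub_infinite_set _ (range f)).
  by move=> _ [n _ <-]; exact: ray_reach_off.
move=> fin; apply: infinite_nat.
have -> : [set: nat] = f @^-1` range f by apply/seteqP; split=> n // _; exists n.
by apply: finite_preimage => // ? ? _ _; exact: finj.
Qed.

(** An injective ray issued from a vertex of [S] leaves this finite set for the last
    time, through the edge from [x] to [y]. *)
Lemma infinite_component_exit H (S : {fset V}) v : locally_finite H -> v \in S ->
  infinite_set (component H v) ->
  exists x y, [/\ x \in S, y \notin S, adj H x y & infinite_set (reach_off H [set` S] y)].
Proof.
move=> lfH vS; rewrite componentE => /(infinite_reach_off_ray lfH)[f [finj f0 _ fH]].
have [N NS] : exists N, forall n, (N <= n)%N -> f n \notin S.
  have : finite_set (f @^-1` [set` S]).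
    by apply: finite_preimage; [move=> ? ? _ _; exact: finj|exact: finite_fset].
  move=> /finite_fsetP[A fA]; exists (\max_(i <- A) i).+1 => n An.
  apply/negP => fn; have : n \in A by have : [set` A] n by rewrite -fA.
  by move=> nA; have := @leq_bigmax_seq _ _ xpredT id n nA isT; rewrite leqNgt An.
have ex : exists N, `[< forall n, (N <= n)%N -> f n \notin S >].
  by exists N; exact/asboolP.
case: (ex_minnP ex) => {NS ex}N /asboolP NS Nmin.
case: N NS Nmin => [|N] NS Nmin; first by have := NS 0%N isT; rewrite f0 vS.
exists (f N), (f N.+1); split => //.
- apply: contraT => fN; suff /Nmin : `[< forall n, (N <= n)%N -> f n \notin S >].
    by rewrite ltnn.
  by apply/asboolP => n; rewrite leq_eqVlt => /predU1P[<-//|]; exact: NS.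
- exact: NS.
- have := @ray_infinite_reach_off H [set` S] (fun n => f (N.+1 + n)%N); rewrite addn0; apply.
  + by move=> m n /finj/addnI.
  + by move=> n; apply/negP; apply: NS; rewrite leq_addr.
  + by move=> n; rewrite addnS; exact: fH.
Qed.

End Reach.

(** * Boundaries and events of the open subgraph *)

Section Boundary.
Variables (V : choiceType) (G : graph V).
Implicit Types (S A W : {fset V}) (J : set V).

Definition boundary S : {fset V * V} := fset_set (oriented_boundary G S).

Lemma in_boundary S (e : V * V) : locally_finite G ->
  (e \in boundary S) = [&& adj G e.1 e.2, e.1 \in S & e.2 \notin S].
Proof.
move=> lf; rewrite in_fset_set; last first.
  apply: (@sub_finite_set _ _ (\bigcup_(x in [set` S]) (pair x @` neighbours G x))).
    by move=> [x y] [/= xy xS yS]; exists x => //; exists y.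
  apply: bigcup_finite; first exact: finite_fset.
  by move=> x _; apply: finite_image; exact: lf.
apply/idP/idP; first by rewrite inE => -[-> -> ->].
by case/and3P => ? ? ?; rewrite inE.
Qed.

Lemma sum_boundary (R : realType) S (F : V * V -> R) : locally_finite G ->
  (\sum_(e \in oriented_boundary G S) (F e)%:E = (\sum_(e <- boundary S) F e)%:E)%E.
Proof.
move=> lf; rewrite fsbig_finite ?sumEFin//.
have -> : oriented_boundary G S = [set` boundary S]; last exact: finite_fset.
apply/seteqP; split=> e /=; rewrite in_boundary//; first by move=> [-> -> ->].
by case/and3P.
Qed.

Lemma is_edge_pair x y : adj G x y -> is_edge G [fset x; y].
Proof. by move=> xy; apply/asboolP; exists x, y. Qed.

(** An unoriented edge leaving [J] has a well-defined inner endpoint, so that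
    oriented boundary edges can be counted as edges. *)
Lemma edges_of_pairs (B : {fset V * V}) J :
  (forall e, e \in B -> [/\ adj G e.1 e.2, J e.1 & ~ J e.2]) ->
  exists F : {fset edge G}, #|` F| = #|` B| /\
    forall e : edge G, e \in F <-> exists2 xy, xy \in B & val e = [fset xy.1; xy.2].
Proof.
move=> BG; have [->|[e0 e0B]] := fset_0Vmem B.
  by exists fset0; split; [rewrite !cardfs0|move=> e; split=> // -[]].
have [G0 _ _] := BG _ e0B.
pose d0 : edge G := exist (is_edge G) _ (is_edge_pair G0).
pose g (xy : V * V) : edge G := insubd d0 [fset xy.1; xy.2].
have gE xy : xy \in B -> val (g xy) = [fset xy.1; xy.2].
  by move=> /BG[xyG _ _]; rewrite val_insubd is_edge_pair.
exists (g @` B)%fset; split.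
  apply: card_in_imfset => /= -[x y] [x' y'] xyB xyB' /(congr1 val).
  rewrite !gE//= => /fsetP E.
  have [/= _ Jx Jy] := BG _ xyB; have [/= _ Jx' Jy'] := BG _ xyB'.
  have := E x; have := E y; rewrite !inE !eqxx orbT /= => /esym/orP[]/eqP yE /esym/orP[]/eqP xE.
  - by move: Jy; rewrite yE.
  - by move: Jy; rewrite yE.
  - by rewrite xE yE.
  - by move: Jy'; rewrite -xE.
move=> e; split; first by move=> /imfsetP[xy /= xyB ->]; exists xy => //; exact: gE.
move=> [xy xyB eE]; apply/imfsetP; exists xy => //=; apply: val_inj.
by rewrite eE gE.
Qed.

Definition touching J : set (edge G) := [set e : edge G | exists2 x, x \in val e & J x].

Lemma fset2_eq (x y a b : V) : [fset x; y] = [fset a; b] ->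
  (x = a /\ y = b) \/ (x = b /\ y = a).
Proof.
move=> /fsetP E; have := E x; have := E y; have := E a; have := E b.
rewrite !inE !eqxx !orbT/= => /orP b_xy /orP a_xy /esym/orP y_ab /esym/orP x_ab.
case: x_ab => /eqP xE; case: y_ab => /eqP yE; subst.
- by case: b_xy => /eqP ->; left.
- by left.
- by right.
- by case: a_xy => /eqP ->; left.
Qed.

Lemma edgeP (e : edge G) : exists x y, adj G x y /\ val e = [fset x; y].
Proof. by case: e => e /= /asboolP. Qed.

Lemma open_adj_sub (w : config G) x y : adj (open_subgraph w) x y -> adj G x y.
Proof.
case/asboolP => e exy _; have [a [b [ab eab]]] := edgeP e.
move: exy; rewrite eab => /fset2_eq[[<- <-]//|[<- <-]].
by rewrite adj_sym.
Qed.

Lemma open_locally_finite (w : config G) : locally_finite G -> locally_finite (open_subgraph w).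
Proof. by move=> lf v; apply: sub_finite_set (lf v) => u; exact: open_adj_sub. Qed.

Lemma le_open_adj (w w' : config G) x y : (forall e, val e = [fset x; y] -> w e -> w' e) ->
  adj (open_subgraph w) x y -> adj (open_subgraph w') x y.
Proof. by move=> ww' /asboolP[e exy we]; apply/asboolP; exists e => //; exact: ww'. Qed.

Definition hull (w : config G) J S : set V :=
  [set u | exists2 v, v \in S & reach_off (open_subgraph w) J v u].

Lemma clusterE (w : config G) v : cluster w v = reach_off (open_subgraph w) set0 v.
Proof. exact: componentE. Qed.

Lemma hull_fset1 w v : hull w set0 [fset v] = cluster w v.
Proof.
apply/seteqP; split=> u; first by move=> [x]; rewrite inE => /eqP ->; rewrite clusterE.
by rewrite clusterE => vu; exists v => //; rewrite inE.
Qed.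

Lemma finite_hull w S : finite_set (hull w set0 S) <-> ~ to_infinity w S.
Proof.
split.
  move=> fin [v vS]; apply; apply: sub_finite_set fin => u; rewrite clusterE => vu.
  by exists v.
move=> ninf; have -> : hull w set0 S = \bigcup_(v in [set` S]) cluster w v.
  by apply/seteqP; split=> u; [move=> [v vS vu]|move=> [v vS]]; rewrite ?clusterE; exists v; rewrite ?clusterE.
apply: bigcup_finite; first exact: finite_fset.
by move=> v vS; apply: contrapT => vinf; apply: ninf; exists v.
Qed.

(** Rays are replaced by infinite sets, which are described by countably many
    conditions on edges. *)
Lemma to_infinity_offE (w : config G) y S : locally_finite G ->
  to_infinity_off w y S <-> infinite_set (reach_off (open_subgraph w) [set` S] y).
Proof.
move=> lf; split.
  move=> [f [finj <- fS fH]]; apply: ray_infinite_reach_off => // n; exact/negP.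
move=> inf; have [f [finj f0 fS fH]] := infinite_reach_off_ray (open_locally_finite w lf) inf.
by exists f; split => // n; apply/negP; exact: fS.
Qed.

Lemma agree_reach_off (w w' : config G) J x :
  (forall e, ~ touching J e -> w e = w' e) ->
  reach_off (open_subgraph w) J x = reach_off (open_subgraph w') J x.
Proof.
move=> ww'; apply/seteqP; split; apply: reach_off_sub => // u v Ju Jv;
  apply: le_open_adj => e euv; rewrite ww' // => -[z];
  by rewrite euv !inE => /orP[]/eqP ->.
Qed.

Lemma agree_hull (w w' : config G) J S :
  (forall e, ~ touching J e -> w e = w' e) -> hull w J S = hull w' J S.
Proof.
by move=> ww'; apply/seteqP; split=> u [v vS vu]; exists v => //; move: vu;
  rewrite (agree_reach_off _ ww').
Qed.

Lemma determined_to_infinity_off y S : locally_finite G ->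
  determined_by (~` touching [set` S]) [set w | to_infinity_off w y S].
Proof.
by move=> lf w w' ww' /=; rewrite !to_infinity_offE// (agree_reach_off _ ww').
Qed.

Lemma increasing_to_infinity_off y S :
  increasing_event [set w : config G | to_infinity_off w y S].
Proof.
move=> w w' ww' [f [finj f0 fS fH]]; exists f; split => // n.
by apply: le_open_adj (fH n) => e _; exact: ww'.
Qed.

Lemma increasing_to_infinity S : increasing_event [set w : config G | to_infinity w S].
Proof.
move=> w w' ww' [v vS vinf]; exists v => //; apply: sub_infinite_set vinf.
rewrite !clusterE; apply: reach_off_sub => // a b _ _; apply: le_open_adj => e _; exact: ww'.
Qed.

Lemma hull_eq_boundary_closed (w : config G) S A x y (e : edge G) :
  hull w set0 S = [set` A] -> x \in A -> y \notin A -> val e = [fset x; y] -> w e = false.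
Proof.
move=> hA xA yA exy; apply/negbTE/negP => we; case/negP: yA.
have : hull w set0 S x by rewrite hA.
move=> [v vS vx]; suff : [set` A] y by [].
rewrite -hA; exists v => //; apply: (reach_off_step vx) => //.
by apply/asboolP; exists e.
Qed.

(** Whether [A] is the union of the clusters that meet [S] is decided by following
    the edges that touch [A]. *)
Lemma determined_hull_eq S A :
  determined_by (touching [set` A]) [set w | hull w set0 S = [set` A]].
Proof.
move=> w w' ww' /= hA; rewrite -hA; apply/seteqP; split=> u [v vS vu].
  suff : reach_off (open_subgraph w') set0 v `<=` hull w set0 S by move=> h; exact: h vu.
  apply: reach_off_ind => [|a b ha _ ab _].
    by exists v => //; apply: reach_off_refl.
  have aA : a \in A by have : [set` A] a by rewrite -hA.
  case: ha => [z zS za]; exists z => //; apply: (reach_off_step za) => //.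
  apply: le_open_adj ab => e eab; rewrite ww'//; exists a => //.
  by rewrite eab !inE eqxx.
exists v => //.
suff : reach_off (open_subgraph w) set0 v `<=`
    (fun u => reach_off (open_subgraph w) set0 v u /\ reach_off (open_subgraph w') set0 v u).
  by move=> /(_ _ vu)[].
apply: reach_off_ind => [|a b [va va'] _ ab _].
  by split; apply: reach_off_refl.
split; first exact: reach_off_step va ab _.
apply: (reach_off_step va') => //.
have aA : a \in A by have : [set` A] a by rewrite -hA; exists v.
apply: le_open_adj ab => e eab; rewrite ww'//; exists a => //.
by rewrite eab !inE eqxx.
Qed.

End Boundary.

(** * Countability and measurability *)

Section Measurable.
Variables (V : choiceType) (G : graph V).
Hypotheses (lf : locally_finite G) (eV : enumerable V).

Lemma enumerable_edge : enumerable (edge G).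
Proof.
apply: (enumerable_surj (g := fun A : {fset V} => insub A)) (enumerable_fset eV).
by move=> e; exists (val e); rewrite valK.
Qed.

Section Family.
Context d (T : measurableType d).
Variables (H : T -> graph V) (J : T -> set V).
Hypothesis mH : forall x y, measurable [set t | adj (H t) x y].
Hypothesis mJ : forall x, measurable [set t | J t x].

Lemma measurable_reach_off x u : measurable [set t | reach_off (H t) (J t) x u].
Proof.
have -> : [set t | reach_off (H t) (J t) x u] = [set t | exists s : seq V,
    path (adj (H t)) x s /\ (last x s = u /\ forall y, y \in x :: s -> ~ J t y)].
  by apply/seteqP; split=> t [s]; [move=> ? ?|move=> [? ?]]; exists s.
apply: measurable_exists; first exact: enumerable_seq.
move=> s; apply: measurable_and.
  elim: s x => [x|y s IH x] /=; first exact: measurable_Prop.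
  have -> : [set t | adj (H t) x y && path (adj (H t)) y s] =
      [set t | adj (H t) x y /\ path (adj (H t)) y s].
    by apply/seteqP; split=> t /andP.
  exact: measurable_and.
apply: measurable_and; first exact: measurable_Prop.
apply: measurable_forall => // y; apply: measurable_imply; first exact: measurable_Prop.
exact: measurable_not.
Qed.

Lemma measurable_infinite (C : T -> set V) : (forall x, measurable [set t | C t x]) ->
  measurable [set t | infinite_set (C t)].
Proof.
move=> mC; have -> : [set t | infinite_set (C t)] =
    [set t | forall A : {fset V}, exists u, C t u /\ u \notin A].
  apply/seteqP; split=> t /= h.
    move=> A; apply: contrapT => nu; apply: h; apply: sub_finite_set (finite_fset A) => u Cu.
    by apply: contrapT => /negP uA; apply: nu; exists u.
  by move=> /finite_fsetP[A CA]; have [u []] := h A; rewrite CA /= => ->.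
apply: measurable_forall; first exact: enumerable_fset.
move=> A; apply: measurable_exists => // u; apply: measurable_and => //; exact: measurable_Prop.
Qed.

Lemma measurable_eq_fset (C : T -> set V) (A : {fset V}) : (forall x, measurable [set t | C t x]) ->
  measurable [set t | C t = [set` A]].
Proof.
move=> mC; have -> : [set t | C t = [set` A]] = [set t | forall u, (C t u -> u \in A) /\ (u \in A -> C t u)].
  apply/seteqP; split=> t /=; first by move=> ->.
  by move=> h; apply/seteqP; split=> u /h.
apply: measurable_forall => // u.
by apply: measurable_and; apply: measurable_imply => //; exact: measurable_Prop.
Qed.

End Family.

Lemma measurable_open_adj d (T : measurableType d) (f : T -> config G) x y :
  (forall e, measurable [set t | f t e]) -> measurable [set t | adj (open_subgraph (f t)) x y].
Proof.
move=> mf; have -> : [set t | adj (open_subgraph (f t)) x y] =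
    [set t | exists e : edge G, val e = [fset x; y] /\ f t e].
  apply/seteqP; split=> t; first by move/asboolP => [e ? ?]; exists e.
  by move=> [e [? ?]]; apply/asboolP; exists e.
apply: measurable_exists; first exact: enumerable_edge.
by move=> e; apply: measurable_and => //; exact: measurable_Prop.
Qed.

Lemma measurable_hull d (T : measurableType d) (f : T -> config G) (J : T -> set V) S u :
  (forall e, measurable [set t | f t e]) -> (forall x, measurable [set t | J t x]) ->
  measurable [set t | hull (f t) (J t) S u].
Proof.
move=> mf mJ; have -> : [set t | hull (f t) (J t) S u] =
    [set t | exists v, v \in S /\ reach_off (open_subgraph (f t)) (J t) v u].
  by apply/seteqP; split=> t [v]; [move=> ? ?|move=> [? ?]]; exists v.
apply: measurable_exists => // v; apply: measurable_and; first exact: measurable_Prop.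
by apply: measurable_reach_off => // x y; exact: measurable_open_adj.
Qed.

Lemma measurable_config_reach_off J x u :
  measurable [set w : config G | reach_off (open_subgraph w) J x u].
Proof.
apply: measurable_reach_off => [a b|a]; last exact: measurable_Prop.
by apply: measurable_open_adj => e; exact: measurable_edge_true.
Qed.

Lemma measurable_infinite_reach_off J x :
  measurable [set w : config G | infinite_set (reach_off (open_subgraph w) J x)].
Proof. by apply: measurable_infinite => u; exact: measurable_config_reach_off. Qed.

Lemma measurable_infinite_cluster x : measurable [set w : config G | infinite_set (cluster w x)].
Proof.
have := measurable_infinite_reach_off set0 x; congr measurable.
by apply/seteqP; split=> w /=; rewrite clusterE.
Qed.

Lemma measurable_to_infinity_off y S : measurable [set w : config G | to_infinity_off w y S].
Proof.
have := measurable_infinite_reach_off [set` S] y; congr measurable.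
by apply/seteqP; split=> w /=; rewrite to_infinity_offE.
Qed.

Lemma measurable_to_infinity S : measurable [set w : config G | to_infinity w S].
Proof.
have -> : [set w : config G | to_infinity w S] = [set w | exists v, v \in S /\ infinite_set (cluster w v)].
  by apply/seteqP; split=> w [v]; [move=> ? ?|move=> [? ?]]; exists v.
apply: measurable_exists => // v; apply: measurable_and; first exact: measurable_Prop.
exact: measurable_infinite_cluster.
Qed.

(** The boundary edges themselves may be open or closed, so that this set depends
    only on the edges that do not touch [S]. *)
Definition escapes S (w : config G) : {fset V * V} :=
  [fset e in boundary G S | `[< to_infinity_off w e.2 S >]].

Lemma in_escapes S w e : e \in escapes S w <-> e \in boundary G S /\ to_infinity_off w e.2 S.
Proof. by rewrite !inE/=; split => [/andP[? /asboolP]|[-> ?]] //; apply/asboolP. Qed.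

Lemma measurable_escapes S B : measurable [set w | escapes S w = B].
Proof.
have -> : [set w | escapes S w = B] = [set w | forall e : V * V,
    (e \in boundary G S /\ to_infinity_off w e.2 S -> e \in B) /\
    (e \in B -> e \in boundary G S /\ to_infinity_off w e.2 S)].
  apply/seteqP; split=> w /=; first by move=> <- e; rewrite in_escapes.
  by move=> h; apply/fsetP => e; apply/idP/idP => [/in_escapes/h|/h/in_escapes].
apply: (measurable_forall (enumerable_prod eV eV)).
have mE (e : V * V) : measurable [set w : config G | e \in boundary G S /\ to_infinity_off w e.2 S].
  by apply: measurable_and; [exact: measurable_Prop|exact: measurable_to_infinity_off].
by move=> e; apply: measurable_and; apply: measurable_imply => //; exact: measurable_Prop.
Qed.

Lemma determined_escapes S B : determined_by (~` touching [set` S]) [set w | escapes S w = B].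
Proof.
move=> w w' ww' /= <-; apply/fsetP => e; apply/idP/idP => /in_escapes[eS eesc];
  apply/in_escapes; split=> //; move: eesc; apply: determined_to_infinity_off => // e' /ww' ->//.
Qed.

End Measurable.

(** * Sprinkling bound *)

Section Sprinkling.
Variables (V : choiceType) (G : graph V) (R : realType).
Hypotheses (lf : locally_finite G) (eV : enumerable V).
Variables (p q r : R) (mu nu rho : probability (config G) R).
Hypotheses (pmu : product_law p mu) (qnu : product_law q nu) (rrho : product_law r rho).
Hypotheses (q01 : 0 <= q <= 1) (rpq : 1 - r = (1 - p) * (1 - q)).
Implicit Types (S A : {fset V}) (w : config G * config G).

Definition mean_escape (m : probability (config G) R) S : R :=
  \sum_(e <- boundary G S) Pr m [set w | to_infinity_off w e.2 S].

Definition infinite_clusters (w : config G) : set V := [set x | infinite_set (cluster w x)].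

Definition joint_hull S A : set (config G * config G) :=
  [set w | hull (join_config w) set0 S = [set` A]].

(** The first configuration is the environment [w.1]; the exploration avoids the
    infinite clusters of that environment in the union of both configurations. *)
Definition joint_hull_off S A : set (config G * config G) :=
  [set w | hull (join_config w) (infinite_clusters w.1) S = [set` A]].

Lemma measurable_fst_config (X : set (config G)) : measurable X ->
  measurable [set w : config G * config G | X w.1].
Proof.
move=> mX; rewrite (_ : [set w | _] = X `*` setT); first exact: measurableX.
by apply/seteqP; split=> w //= [].
Qed.

Lemma measurable_joint_hull S A : measurable (joint_hull S A).
Proof.
apply: measurable_eq_fset => // x; apply: measurable_hull => // y.
  exact: measurable_join_config.
exact: measurable_Prop.
Qed.

Lemma measurable_joint_hull_off S A : measurable (joint_hull_off S A).
Proof.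
apply: measurable_eq_fset => // x; apply: measurable_hull => // y.
  exact: measurable_join_config.
exact: (measurable_fst_config (measurable_infinite_cluster eV y)).
Qed.

Lemma measurable_escapes_fst A B : measurable [set w : config G * config G | escapes A w.1 = B].
Proof. exact: (measurable_fst_config (measurable_escapes lf eV A B)). Qed.

(** A finite cluster of the sprinkled configuration cannot meet an infinite cluster
    of the smaller configuration [w.1], so avoiding the latter changes nothing. *)
Lemma joint_hull_sub S A : joint_hull S A `<=` joint_hull_off S A.
Proof.
move=> w hA; have Ifin x : hull (join_config w) set0 S x -> ~ infinite_clusters w.1 x.
  move=> [v vS vx]; apply; apply: (@sub_finite_set _ _ [set` A]); last exact: finite_fset.
  rewrite clusterE -hA => u xu; exists v => //; apply: reach_off_trans vx _.
  move: u xu; apply: reach_off_sub => // a b _ _; apply: le_open_adj => e _.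
  by rewrite /join_config => ->.
rewrite /joint_hull_off /= -hA; apply/seteqP; split=> u [v vS vu]; exists v => //.
  by move: u vu; apply: reach_off_sub.
suff : reach_off (open_subgraph (join_config w)) set0 v `<=`
   reach_off (open_subgraph (join_config w)) (infinite_clusters w.1) v by move=> h; exact: h.
have hv x : reach_off (open_subgraph (join_config w)) set0 v x -> ~ infinite_clusters w.1 x.
  by move=> vx; apply: Ifin; exists v.
move=> {u vu} u vu; suff : reach_off (open_subgraph (join_config w)) set0 v u /\
   reach_off (open_subgraph (join_config w)) (infinite_clusters w.1) v u by case.
move: u vu; apply: reach_off_ind => [|a b [va va'] _ ab _].
  by split; apply: reach_off_refl => //; apply: hv; apply: reach_off_refl.
have vb : reach_off (open_subgraph (join_config w)) set0 v b by exact: reach_off_step va ab _.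
by split => //; apply: reach_off_step va' ab _; exact: hv.
Qed.

(** If [A] is a finite cluster of the sprinkled configuration, the edges through
    which it could escape in [w.1] all failed to open in the sprinkling. They touch
    infinite clusters of [w.1], so the exploration off these clusters does not
    inspect them, and given [w.1] their closure is independent of its outcome. *)
Lemma Pr_joint_hull_escapes S A B :
  expR (q * #|` B|%:R) * Pr (mu \x nu)%E (joint_hull S A `&` [set w | escapes A w.1 = B]) <=
  Pr (mu \x nu)%E (joint_hull_off S A `&` [set w | escapes A w.1 = B]).
Proof.
rewrite -[leRHS]mul1r; apply: le_Pr_prod_fibre1; rewrite ?expR_ge0//.
- by apply: measurableI; [exact: measurable_joint_hull|exact: measurable_escapes_fst].
- by apply: measurableI; [exact: measurable_joint_hull_off|exact: measurable_escapes_fst].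
move=> w1; have [eB|neB] := pselect (escapes A w1 = B); last first.
  rewrite (_ : [set y | _] = set0) ?Pr_set0 ?mulr0 ?mul1r ?Pr_ge0//.
  by apply/seteqP; split=> y //= [].
have BG e : e \in B -> [/\ adj G e.1 e.2, e.1 \in A & e.2 \notin A].
  by rewrite -eB => /in_escapes[]; rewrite in_boundary// => /and3P[].
have [F [cF FP]] : exists F : {fset edge G}, #|` F| = #|` B| /\
    forall e : edge G, e \in F <-> exists2 xy, xy \in B & val e = [fset xy.1; xy.2].
  apply: (edges_of_pairs (J := [set` A])) => e /BG[? ? ?]; split => //; exact/negP.
set X := (X in _ * Pr nu X <= _); rewrite mul1r.
set Y := (Y in _ <= Pr nu Y).
pose E := [set y | joint_hull_off S A (w1, y)].
have mE : measurable E.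
  have := measurable_xsection w1 (measurable_joint_hull_off S A).
  by rewrite xsectionE.
have mX : measurable X.
  have : measurable (joint_hull S A `&` [set w | escapes A w.1 = B]).
    by apply: measurableI; [exact: measurable_joint_hull|exact: measurable_escapes_fst].
  by move=> /(measurable_xsection w1); rewrite xsectionE.
have -> : Y = E by apply/seteqP; split=> y //= [].
have XE : X `<=` closed_on F `&` E.
  move=> y [/= hA _]; split; last exact: joint_hull_sub.
  move=> e /FP[xy /BG[_ xA yA] eE].
  have := hull_eq_boundary_closed hA xA yA eE.
  by rewrite /join_config/= => /negbT; rewrite negb_or => /andP[_ /negbTE].
have indep : Pr nu (closed_on F `&` E) = (1 - q) ^+ #|` B| * Pr nu E.
  rewrite -cF -qnu; apply: (Pr_independent qnu (F := [set` F])) => //.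
  - exact: measurable_closed_on.
  - by move=> y y' yy' cy e eF; rewrite -yy'//; exact: cy.
  - move=> y y' yy'; rewrite /E/= /joint_hull_off/= => <-.
    apply: agree_hull => e ntouch; rewrite /join_config/=; congr (_ || _).
    apply/esym/yy' => eF; apply: ntouch.
    have [xy xyB eE] := (FP e).1 eF; exists xy.2; first by rewrite eE !inE eqxx orbT.
    move: xyB; rewrite -eB => /in_escapes[_]; rewrite to_infinity_offE//.
    rewrite /infinite_clusters/= clusterE; apply: sub_infinite_set.
    exact: reach_off_sub.
apply: (@le_trans _ _ (expR (q * #|` B|%:R) * ((1 - q) ^+ #|` B| * Pr nu E))).
  rewrite ler_wpM2l ?expR_ge0// -indep; apply: le_Pr => //.
  by apply: measurableI => //; exact: measurable_closed_on.
rewrite mulrA ler_piMl ?Pr_ge0//.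
rewrite mulrC expRM_natr -exprMn exprn_ile1//.
  by rewrite mulr_ge0 ?expR_ge0// subr_ge0; case/andP: q01.
rewrite -ler_pdivlMr ?expR_gt0// mul1r -expRN; exact: expR_ge1Dx.
Qed.

(** The escaping edges of [A] in [w.1] are independent of [joint_hull S A], which is
    decided by edges touching [A]; then apply Jensen to their number. *)
Lemma Pr_joint_hull_le S A :
  expR (q * mean_escape mu A) * Pr (mu \x nu)%E (joint_hull S A) <=
  Pr (mu \x nu)%E (joint_hull_off S A).
Proof.
set bd := boundary G A; have mj := measurable_joint_hull S A.
have mjo := measurable_joint_hull_off S A.
have ND (w : config G * config G) : escapes A w.1 \in fpowerset bd.
  by rewrite fpowersetE; apply/fsubsetP => e /in_escapes[].
rewrite (Pr_partition (mu \x nu)%E mjo (measurable_escapes_fst A) ND).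
have jensen := expR_sum_Pr_le mu (D := bd) q
  (fun e : V * V => measurable_to_infinity_off lf eV e.2 A) (measurable_escapes lf eV A)
  (fun (w : config G) e => in_escapes A w e).
apply: le_trans (ler_wpM2r (Pr_ge0 _ _) jensen) _; rewrite mulr_suml.
apply: ler_sum => B _; apply: le_trans (Pr_joint_hull_escapes S A B).
rewrite mulrAC mulrC ler_wpM2l ?expR_ge0//.
rewrite -[leRHS]mul1r; apply: le_Pr_prod_fibre2 => //; first exact: Pr_ge0.
  by apply: measurableI => //; exact: measurable_escapes_fst.
move=> y; rewrite mul1r.
rewrite (_ : [set x | _ (x, y)] = [set x | joint_hull S A (x, y)]) //.
rewrite [in leRHS](_ : [set x | _] = [set x | joint_hull S A (x, y)] `&` [set x | escapes A x = B]) //.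
have mjy : measurable [set x | joint_hull S A (x, y)].
  by have := measurable_ysection y mj; rewrite ysectionE.
rewrite (Pr_independent pmu (F := touching [set` A])) 1?mulrC//.
- exact: measurable_escapes.
- move=> x x' xx' hx; apply: (determined_hull_eq (w := join_config (x, y))) hx => e eA.
  by rewrite /join_config/= xx'.
- exact: determined_escapes.
Qed.

(** The exploration off the infinite clusters of [w.1] has disjoint outcomes, so
    the weights above sum to at most one. *)
Lemma Pr_finite_hull_le S (n : nat) (b : R) :
  (forall A, (n <= #|` A|)%N -> S `<=` A -> b <= mean_escape mu A)%fset ->
  Pr rho [set w | exists A, hull w set0 S = [set` A] /\ (n <= #|` A|)%N] <= expR (- (q * b)).
Proof.
move=> bA; have mX A : measurable [set w : config G | hull w set0 S = [set` A]].
  apply: measurable_eq_fset => // x; apply: measurable_hull => // y.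
    exact: measurable_edge_true.
  exact: measurable_Prop.
have mU : measurable [set w : config G | exists A, hull w set0 S = [set` A] /\ (n <= #|` A|)%N].
  apply: measurable_exists => [|A]; first exact: enumerable_fset.
  by apply: measurable_and => //; exact: measurable_Prop.
rewrite -(Pr_sprinkle pmu qnu rrho rpq)// -[leRHS]mulr1 -(Pr_setT (mu \x nu)%E).
apply: (Pr_disjoint_domination (mu := (mu \x nu)%E)
  (X := fun A => [set w | joint_hull S A w /\ (n <= #|` A|)%N]) (Y := joint_hull_off S)) => //.
- exact: enumerable_fset.
- rewrite -[X in measurable X]setTI; apply: measurable_to_config => //.
  exact: measurable_join_config.
- by move=> A; apply: measurable_and; [exact: measurable_joint_hull|exact: measurable_Prop].
- by move=> A; exact: measurable_joint_hull_off.
- move=> A B w hA hB; apply/fsetP => x.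
  have : [set` A] = [set` B] by rewrite -hA -hB.
  by move=> /seteqP[AB BA]; apply/idP/idP => [/AB|/BA].
- move=> A; have [nA|nA] := boolP (n <= #|` A|)%N; last first.
    rewrite (_ : [set w | _] = set0); first by rewrite Pr_set0 mulr_ge0 ?expR_ge0 ?Pr_ge0.
    by apply/seteqP; split=> w // -[].
  rewrite (_ : [set w | _] = joint_hull S A); last first.
    by apply/seteqP; split=> w /=; [case|].
  have [SA|SA] := boolP (S `<=` A)%fset; last first.
    rewrite (_ : joint_hull S A = set0); first by rewrite Pr_set0 mulr_ge0 ?expR_ge0 ?Pr_ge0.
    apply/seteqP; split=> w // hA; case/negP: SA; apply/fsubsetP => v vS.
    suff : [set` A] v by [].
    by rewrite -hA; exists v => //; exact: reach_off_refl.
  rewrite expRN -ler_pdivrMl ?invr_gt0 ?expR_gt0// invrK.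
  apply: le_trans (Pr_joint_hull_le S A).
  rewrite ler_wpM2r ?Pr_ge0// ler_expR ler_wpM2l ?bA//.
  by case/andP: q01.
Qed.

End Sprinkling.

(** * Disconnection, escape and finite clusters *)

Section Escape.
Variables (V : choiceType) (G : graph V) (R : realType).
Hypotheses (lf : locally_finite G) (eV : enumerable V).
Variables (p : R) (mu : probability (config G) R).
Hypothesis pmu : product_law p mu.
Implicit Types (S A : {fset V}).

Lemma sum_escape S : (\sum_(e \in oriented_boundary G S) mu [set w | to_infinity_off w e.2 S] =
  (mean_escape mu S)%:E)%E.
Proof.
rewrite -sum_boundary//; apply: eq_fsbigr => e _; rewrite PrE//.
exact: measurable_to_infinity_off.
Qed.

(** Closing the escaping edges disconnects [S]. They touch [S], so that given which
    edges escape each of them costs a factor [1 - p]. *)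
Lemma Pr_disconnected_ge S (a : R) : expR a = 1 - p ->
  expR (a * mean_escape mu S) <= Pr mu [set w | ~ to_infinity w S].
Proof.
move=> ea; set bd := boundary G S.
have mN : measurable [set w : config G | ~ to_infinity w S].
  by apply: measurable_not; exact: measurable_to_infinity eV S.
have mE := measurable_escapes lf eV S.
have jensen := expR_sum_Pr_le mu (D := bd) a
  (fun e : V * V => measurable_to_infinity_off lf eV e.2 S) mE
  (fun (w : config G) e => in_escapes S w e).
apply: (le_trans jensen).
have ND (w : config G) : escapes S w \in fpowerset bd.
  by rewrite fpowersetE; apply/fsubsetP => e /in_escapes[].
rewrite (Pr_partition mu mN mE ND); apply: ler_sum => B _.
have [[w0 eB]|nB] := pselect (exists w0 : config G, escapes S w0 = B); last first.
  rewrite (_ : [set w | _ = B] = set0) ?setI0 ?Pr_set0 ?mul0r//.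
  by apply/seteqP; split=> w // eB; apply: nB; exists w.
have BG e : e \in B -> [/\ adj G e.1 e.2, e.1 \in S & e.2 \notin S].
  by rewrite -eB => /in_escapes[]; rewrite in_boundary// => /and3P[].
have [F [cF FP]] : exists F : {fset edge G}, #|` F| = #|` B| /\
    forall e : edge G, e \in F <-> exists2 xy, xy \in B & val e = [fset xy.1; xy.2].
  apply: (edges_of_pairs (J := [set` S])) => e /BG[? ? ?]; split => //; exact/negP.
rewrite expRM_natr ea -cF -pmu mulrC.
rewrite -(Pr_independent pmu (F := touching [set` S])) //.
- apply: le_Pr.
  + by apply: measurableI => //; exact: measurable_closed_on.
  + exact: measurableI.
  + move=> w [cw eW]; split => // -[v vS vinf].
    have [x [y [xS yS xy yinf]]] := infinite_component_exit (open_locally_finite w lf) vS vinf.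
    have /asboolP[e exy we] := xy.
    suff : w e = false by rewrite we.
    apply: cw; apply/FP; exists (x, y) => //; rewrite -eW; apply/in_escapes.
    rewrite in_boundary//= xS yS (open_adj_sub xy); split => //.
    by rewrite to_infinity_offE.
- exact: measurable_closed_on.
- move=> w w' ww' cw e eF; have [xy xyB eE] := (FP e).1 eF.
  rewrite -ww' ?cw//; exists xy.1; first by rewrite eE !inE eqxx.
  by have [] := BG _ xyB.
- exact: determined_escapes.
Qed.

End Escape.

Lemma powR_card_mono (R : realType) (a : R) (m n : nat) : 0 <= a -> (m <= n)%N ->
  m%:R `^ a <= n%:R `^ a :> R.
Proof. by move=> a0 mn; rewrite ge0_ler_powR ?nnegrE ?ler0n ?ler_nat. Qed.

Lemma exponent_bounds (R : realType) (d : R) : 1 < d -> 0 < (d - 1) / d < 1.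
Proof.
move=> d1; have d0 : 0 < d by lra.
by rewrite divr_gt0//= ?ltr_pdivrMr//; lra.
Qed.

Section Equivalences.
Variables (V : choiceType) (G : graph V) (R : realType) (P : R -> probability (config G) R).
Variables (p0 : R) (d : \bar R).
Hypothesis P_perc : forall p : R, 0 <= p <= 1 -> bernoulli_percolation p (P p).
Hypotheses (lf : locally_finite G) (eV : enumerable V) (p0_range : 0 <= p0 < 1).

Lemma percolation_law (p : R) : 0 <= p <= 1 -> product_law p (P p).
Proof. by move=> /P_perc; exact: bernoulli_product_law. Qed.

Lemma sprinkling_rate (p p' : R) : 0 <= p -> p < p' -> p' <= 1 ->
  exists2 q : R, 0 < q <= 1 & 1 - p' = (1 - p) * (1 - q).
Proof.
move=> p_ge0 pp' p'1; exists ((p' - p) / (1 - p)); last by field; lra.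
by rewrite divr_gt0 ?ler_pdivrMr; lra.
Qed.

Lemma le_Pr_increasing (p p' : R) X : 0 <= p -> p <= p' -> p' <= 1 -> measurable X ->
  increasing_event X -> Pr (P p) X <= Pr (P p') X.
Proof.
move=> p_ge0; rewrite le_eqVlt => /predU1P[->//|pp'] p'1 mX iX.
have [q q01 e] := sprinkling_rate p_ge0 pp' p'1.
by apply: (Pr_increasing (percolation_law _) (percolation_law (p := q) _) (percolation_law _) e mX iX); lra.
Qed.

Lemma le_mean_escape (p p' : R) S : 0 <= p -> p <= p' -> p' <= 1 ->
  mean_escape (P p) S <= mean_escape (P p') S.
Proof.
move=> p_ge0 pp' p'1; apply: ler_sum => e _; apply: le_Pr_increasing => //.
  exact: measurable_to_infinity_off.
exact: increasing_to_infinity_off.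
Qed.

Lemma boundary_escapeE : boundary_escape P p0 d <-> forall p d' : R,
  p0 < p <= 1 -> 1 < d' -> (d'%:E < d)%E -> exists2 c : R, 0 < c &
    forall S, S != fset0 -> c * #|` S|%:R `^ ((d' - 1) / d') <= mean_escape (P p) S.
Proof.
by split=> h p d' h1 h2 h3; have [c c0 hc] := h p d' h1 h2 h3; exists c => // S S0;
  have := hc S S0; rewrite sum_escape// lee_fin.
Qed.

Lemma disconnection_decayE : disconnection_decay P p0 d <-> forall p d' : R,
  p0 < p <= 1 -> 1 < d' -> (d'%:E < d)%E -> exists2 c : R, 0 < c &
    forall S, S != fset0 -> Pr (P p) [set w | ~ to_infinity w S] <=
      expR (- (c * #|` S|%:R `^ ((d' - 1) / d'))).
Proof.
have mN S : measurable [set w : config G | ~ to_infinity w S].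
  by apply: measurable_not; exact: measurable_to_infinity eV S.
by split=> h p d' h1 h2 h3; have [c c0 hc] := h p d' h1 h2 h3; exists c => // S S0;
  have := hc S S0; rewrite (PrE _ (mN S)) lee_fin.
Qed.

(** The parameter [1] is reached by monotonicity from any smaller one. *)
Lemma disconnection_decay_escape : disconnection_decay P p0 d -> boundary_escape P p0 d.
Proof.
have /andP[p0_ge0 p0_lt1] := p0_range.
rewrite disconnection_decayE boundary_escapeE => decay.
have below (p d' : R) : p0 < p < 1 -> 1 < d' -> (d'%:E < d)%E -> exists2 c : R, 0 < c &
    forall S, S != fset0 -> c * #|` S|%:R `^ ((d' - 1) / d') <= mean_escape (P p) S.
  move=> p_range d'1 d'd; have [|c c0 hc] := decay p d' _ d'1 d'd; first by lra.
  have lnp : ln (1 - p) < 0 by rewrite ln_lt0//; lra.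
  exists (c / - ln (1 - p)); first by rewrite divr_gt0// oppr_gt0.
  move=> S /hc decS; rewrite mulrAC ler_pdivrMr ?oppr_gt0//.
  have lnE : expR (ln (1 - p)) = 1 - p by rewrite lnK// posrE; lra.
  have pE : 0 <= p <= 1 by lra.
  have := le_trans (Pr_disconnected_ge lf eV (percolation_law pE) S lnE) decS.
  by rewrite ler_expR; lra.
move=> p d' p_range d'1 d'd; have [|c c0 hc] := below ((p0 + p) / 2) d' _ d'1 d'd; first by lra.
exists c => // S /hc cS; apply: (le_trans cS); apply: le_mean_escape; lra.
Qed.

(** Half of the distance from [p0] to [p] is used as environment and the other half
    as sprinkling. *)
Lemma escape_tail : boundary_escape P p0 d -> forall p d' : R,
  p0 < p <= 1 -> 1 < d' -> (d'%:E < d)%E -> exists2 c : R, 0 < c &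
    forall S (n : nat), S != fset0 ->
    Pr (P p) [set w | exists A, hull w set0 S = [set` A] /\ (n <= #|` A|)%N] <=
      expR (- (c * n%:R `^ ((d' - 1) / d'))).
Proof.
rewrite boundary_escapeE => esc p d' p_range d'1 d'd.
have /andP[p0_ge0 p0_lt1] := p0_range; have /andP[pp0 p_le1] := p_range.
have [p1 p1E] : exists p1 : R, p1 = (p0 + p) / 2 by eexists.
have [|c c0 hc] := esc p1 d' _ d'1 d'd; first by lra.
have [q q01 e] : exists2 q : R, 0 < q <= 1 & 1 - p = (1 - p1) * (1 - q).
  by apply: sprinkling_rate; lra.
exists (q * c); first by rewrite mulr_gt0//; lra.
move=> S n S0; rewrite -mulrA.
have lp1 : 0 <= p1 <= 1 by lra.
have lq : 0 <= q <= 1 by lra.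
have lp : 0 <= p <= 1 by lra.
apply: (Pr_finite_hull_le lf eV (percolation_law lp1) (percolation_law lq) (percolation_law lp) lq e).
move=> A nA SA; apply: le_trans (hc A _).
  rewrite ler_wpM2l ?(ltW c0)// powR_card_mono//.
  by have /andP[/ltW] := exponent_bounds d'1.
by apply: contraNneq S0 => A0; rewrite -fsubset0 -A0.
Qed.

Lemma escape_disconnection_decay : boundary_escape P p0 d -> disconnection_decay P p0 d.
Proof.
move=> /escape_tail tail; apply/disconnection_decayE => p d' p_range d'1 d'd.
have [c c0 hc] := tail p d' p_range d'1 d'd; exists c => // S S0.
have := hc S #|` S| S0; congr (Pr _ _ <= _); apply/seteqP; split=> w /=.
  move=> [A [hA _]]; apply/finite_hull; rewrite hA; exact: finite_fset.
move=> /finite_hull/finite_fsetP[A hA]; exists A; split=> //.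
apply: fsubset_leq_card; apply/fsubsetP => v vS; suff : [set` A] v by [].
by rewrite -hA; exists v => //; exact: reach_off_refl.
Qed.

Lemma measurable_cluster_size v n : measurable [set w : config G |
  finite_set (cluster w v) /\ (n <= #|` fset_set (cluster w v)|)%N].
Proof.
have -> : [set w : config G | finite_set (cluster w v) /\ (n <= #|` fset_set (cluster w v)|)%N] =
    [set w | exists A, cluster w v = [set` A] /\ (n <= #|` A|)%N].
  apply/seteqP; split=> w /=.
    by move=> [/finite_fsetP[A wA]]; exists A; split => //; rewrite -(set_fsetK A) -wA.
  by move=> [A [-> nA]]; split; [exact: finite_fset|rewrite set_fsetK].
apply: measurable_exists => [|A]; first exact: enumerable_fset.
apply: measurable_and; last exact: measurable_Prop.
apply: measurable_eq_fset => // x.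
rewrite (_ : [set t | _] = [set w : config G | reach_off (open_subgraph w) set0 v x]).
  exact: measurable_config_reach_off.
by apply/seteqP; split=> w /=; rewrite clusterE.
Qed.

Lemma escape_finite_cluster_decay : boundary_escape P p0 d -> finite_cluster_decay P p0 d.
Proof.
move=> /escape_tail tail p d' p_range d'1 d'd.
have [c c0 hc] := tail p d' p_range d'1 d'd; exists c => // v n _.
rewrite (PrE _ (measurable_cluster_size v n)) lee_fin.
have v0 : [fset v] != fset0 by apply/fset0Pn; exists v; rewrite inE.
have := hc [fset v] n v0; congr (Pr _ _ <= _); apply/seteqP; split=> w /=; rewrite hull_fset1.
  by move=> [A [-> nA]]; split; [exact: finite_fset|rewrite set_fsetK].
by move=> [/finite_fsetP[A ->] nA]; exists A; rewrite set_fsetK in nA.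
Qed.

End Equivalences.

(** * From anchored isoperimetry to escape *)

Section Anchored.
Variables (V : choiceType) (R : realType).
Implicit Types (H : graph V) (W S : {fset V}).

Definition connected_from H W v := v \in W /\ forall u, u \in W -> reach_off H (~` [set` W]) v u.

(** Isoperimetry at the anchor [v] in terms of numbers of vertices; for bounded degree
    and infinite clusters these are comparable to sums of degrees. *)
Definition anchored_at H (c a : R) v := forall W, connected_from H W v ->
  c * #|` W|%:R `^ a <= #|` boundary H W|%:R.

Lemma reach_off_within H J x u : reach_off H J x u -> reach_off H (~` reach_off H J x) x u.
Proof.
move=> xu; have [Jx _] := reach_off_notin xu.
suff : reach_off H J x u /\ reach_off H (~` reach_off H J x) x u by case.
move: u xu; apply: reach_off_ind => [|a b [xa xa'] Ja ab Jb].
  by split; apply: reach_off_refl => //; apply; exact: reach_off_refl.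
have xb : reach_off H J x b by exact: reach_off_step xa ab Jb.
by split => //; apply: (reach_off_step xa' ab); apply.
Qed.

Lemma finite_connected_boundary H W v : locally_finite H -> connected_from H W v ->
  infinite_set (component H v) -> boundary H W != fset0.
Proof.
move=> lf [vW _] vinf; have [x [y [xW yW xy _]]] := infinite_component_exit lf vW vinf.
by apply/fset0Pn; exists (x, y); rewrite in_boundary//= xy xW.
Qed.

End Anchored.

(** Give each good [u] the weight of the items in its class divided by the size of
    that class: an item then receives total weight at most one. *)
Lemma class_double_counting (R : realType) (V : choiceType) (I : choiceType) (S : {fset V})
    (E : {fset I}) (h : I -> V) (r : V -> V -> bool) (g : pred V) (K : R) :
  0 <= K -> (forall e, e \in E -> h e \in S) ->
  {in S, reflexive r} -> {in S &, symmetric r} -> {in S & &, transitive r} ->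
  (forall u, u \in S -> g u ->
    K * (\sum_(x <- S) (r u x)%:R) <= \sum_(e <- E) (r u (h e))%:R) ->
  K * (\sum_(u <- S) (g u)%:R) <= #|` E|%:R.
Proof.
move=> K0 hS rr rs rt gS; pose s u : R := \sum_(x <- S) (r u x)%:R.
have s_gt0 u : u \in S -> 0 < s u.
  move=> uS; rewrite /s (big_fsetD1 u)//= rr//; apply: ltr_pwDl => //.
  by apply: sumr_ge0 => x _.
have s_eq u v : u \in S -> v \in S -> r u v -> s u = s v.
  move=> uS vS uv; apply: eq_big_seq => x xS; congr (_ : bool)%:R.
  apply/idP/idP => rx; last exact: rt uv rx.
  by apply: rt rx => //; rewrite rs.
apply: (@le_trans _ _ (\sum_(u <- S) (s u)^-1 * \sum_(e <- E) (r u (h e))%:R)).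
  rewrite mulr_sumr big_seq [leRHS]big_seq; apply: ler_sum => u uS.
  have su := s_gt0 u uS; rewrite ler_pdivlMl// mulrC.
  case: (boolP (g u)) => gu; last by rewrite mulr0 mul0r; apply: sumr_ge0.
  by rewrite mulr1; exact: gS.
under eq_bigr do rewrite mulr_sumr.
rewrite exchange_big/= big_seq.
apply: (@le_trans _ _ (\sum_(e <- E | e \in E) 1)); last first.
  by rewrite -big_seq big_const_seq count_predT iter_addr_0.
apply: ler_sum => e eE; have he := hS e eE.
rewrite le_eqVlt; apply/orP; left; apply/eqP.
transitivity (\sum_(u <- S) (s (h e))^-1 * (r (h e) u)%:R).
  apply: eq_big_seq => u uS; rewrite (rs (h e))//.
  by case: (boolP (r u (h e))) => rue; rewrite ?mulr0// (s_eq _ (h e)).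
by rewrite -mulr_sumr mulVf// gt_eqF// s_gt0.
Qed.

Lemma powR_subr1 (R : realType) (x a : R) : 0 < x -> x `^ a = x `^ (a - 1) * x.
Proof.
move=> x0; have E : x `^ 1 = x by rewrite powRr1// ltW.
transitivity (x `^ (a - 1) * x `^ 1); last by rewrite E.
by rewrite -powRD ?subrK// (gt_eqF x0) implybT.
Qed.

Section GoodVertices.
Variables (V : choiceType) (G : graph V) (R : realType).
Hypotheses (lf : locally_finite G) (eV : enumerable V).
Implicit Types (S W : {fset V}) (w : config G).

Definition good (c a : R) (v : V) : set (config G) :=
  [set w | infinite_set (cluster w v) /\ anchored_at (open_subgraph w) c a v].

Lemma measurable_open_boundary (Q : {fset V * V} -> Prop) W :
  measurable [set w : config G | Q (boundary (open_subgraph w) W)].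
Proof.
have -> : [set w : config G | Q (boundary (open_subgraph w) W)] =
    [set w | exists B, [set` boundary (open_subgraph w) W] = [set` B] /\ Q B].
  apply/seteqP; split=> w /=; first by exists (boundary (open_subgraph w) W).
  move=> [B [/seteqP[wB Bw] QB]]; rewrite (_ : boundary _ _ = B)//.
  by apply/fsetP => e; apply/idP/idP => [/wB|/Bw].
apply: measurable_exists => [|B]; first by apply: enumerable_fset; exact: enumerable_prod.
apply: measurable_and; last exact: measurable_Prop.
apply: measurable_eq_fset; first exact: enumerable_prod.
move=> [x y]; have -> : [set w : config G | [set` boundary (open_subgraph w) W] (x, y)] =
   [set w | adj (open_subgraph w) x y /\ (x \in W /\ y \notin W)].
  apply/seteqP; split=> w /=; rewrite in_boundary//=; try exact: open_locally_finite.
    by case/and3P.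
  by move=> [-> [-> ->]].
apply: measurable_and; last exact: measurable_Prop.
by apply: measurable_open_adj => // e; exact: measurable_edge_true.
Qed.

Lemma measurable_connected_from W v :
  measurable [set w : config G | connected_from (open_subgraph w) W v].
Proof.
apply: measurable_and; first exact: measurable_Prop.
apply: measurable_forall => // u; apply: measurable_imply; first exact: measurable_Prop.
exact: measurable_config_reach_off.
Qed.

Lemma measurable_good c a v : measurable (good c a v).
Proof.
apply: measurable_and; first exact: measurable_infinite_cluster.
apply: measurable_forall => [|W]; first exact: enumerable_fset.
apply: measurable_imply; first exact: measurable_connected_from.
exact: (measurable_open_boundary (fun B => c * #|` W|%:R `^ a <= #|` B|%:R)).
Qed.

Section Pointwise.
Variables (w : config G) (S : {fset V}).
Local Notation H := (open_subgraph w).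

(** The components off [outer] that meet [S] consist of vertices of [S] joined by
    finite pieces hanging off [S], and can only be left through escaping edges. *)
Definition outer : set V := [set x | x \notin S /\ infinite_set (reach_off H [set` S] x)].

(** The pieces hanging off [S] are finite and each contains a neighbour of [S], so
    that there are finitely many of them. *)
Lemma finite_reach_off_outer u : u \in S -> finite_set (reach_off H outer u).
Proof.
move=> uS; have lfH : locally_finite H by exact: open_locally_finite.
pose fringe z := neighbours H z `&` [set y | y \notin S /\ ~ outer y].
apply: (@sub_finite_set _ _ ([set` S] `|` \bigcup_(z in [set` S])
    \bigcup_(y in fringe z) reach_off H [set` S] y)).
  apply: reach_off_ind; first by left.
  move=> x y; have [yS|yS] := boolP (y \in S); first by left.
  move=> hx nx xy ny; right; case: hx => [xS|[z zS [t tz tx]]].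
    exists x => //; exists y; first by [].
    by apply: reach_off_refl; apply/negP.
  by exists z => //; exists t => //; apply: reach_off_step tx xy _; exact/negP.
rewrite finite_setU; split; first exact: finite_fset.
apply: bigcup_finite => [|z _]; first exact: finite_fset.
apply: bigcup_finite => [|y [_ [yS ny]]]; first by apply: sub_finite_set (lfH z) => y [].
by apply: contrapT => yinf; apply: ny.
Qed.

(** If [x] were outside [S], the step from [x] to [y] would connect [x] to infinity off
    [S], so that [x] would be in [outer]. *)
Lemma boundary_reach_off_outer u A x y : reach_off H outer u = [set` A] ->
  (x, y) \in boundary H A -> (x, y) \in escapes S w /\ reach_off H outer u x.
Proof.
move=> uA; rewrite in_boundary/=; last exact: open_locally_finite.
move=> /and3P[xy xA yA]; have ux : reach_off H outer u x by rewrite uA.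
have [_ nx] := reach_off_notin ux.
have [yS yinf] : outer y.
  apply: contrapT => ny; move/negP: yA; apply; suff : [set` A] y by [].
  by rewrite -uA; exact: reach_off_step ux xy ny.
split => //; apply/in_escapes; rewrite in_boundary//= (open_adj_sub xy) yS to_infinity_offE//.
split => //; rewrite andbT; apply: contrapT => /negP xS; apply: nx; split => //.
have xxS : ~ [set` S] x by exact/negP.
apply: infinite_reach_off_eq yinf; apply: (reach_off_step (reach_off_refl _ _)) => //.
  exact/negP.
by rewrite adj_sym.
Qed.

(** The component of a good [u] has at least [c s ^ a >= c s #|S| ^ (a - 1)] escaping
    edges, where [s <= #|S|] is the number of vertices of [S] that it contains. *)
Lemma good_le_escapes (c a : R) : 0 < c -> 0 <= a <= 1 -> S != fset0 ->
  c * #|` S|%:R `^ (a - 1) * \sum_(u <- S) (`[< good c a u w >])%:R <= #|` escapes S w|%:R.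
Proof.
move=> c0 /andP[a0 a1] S0; have cS : (0 < #|` S|)%N by rewrite cardfs_gt0.
have lfH : locally_finite H by exact: open_locally_finite.
have nouter u : u \in S -> ~ outer u by move=> uS []; rewrite uS.
apply: (@class_double_counting _ _ _ S _ fst (fun u x => `[< reach_off H outer u x >])).
- by rewrite mulr_ge0 ?powR_ge0// ltW.
- by move=> e /in_escapes[]; rewrite in_boundary// => /and3P[].
- by move=> u uS; apply/asboolP; apply: reach_off_refl; exact: nouter.
- by move=> u v uS vS; apply/asboolP/asboolP; exact: reach_off_sym.
- by move=> u v x uS vS xS /asboolP uv /asboolP vx; apply/asboolP; exact: reach_off_trans uv vx.
move=> u uS /asboolP[_ anch].
have [A uA] : exists A : {fset V}, reach_off H outer u = [set` A].
  by apply/finite_fsetP; exact: finite_reach_off_outer.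
have uu : reach_off H outer u u by apply: reach_off_refl; exact: nouter.
have Aconn : connected_from H A u.
  split; first by have : [set` A] u by rewrite -uA.
  by move=> x xA; rewrite -uA; apply: reach_off_within; rewrite uA.
have {anch}anch := anch A Aconn.
set s := \sum_(x <- S) _.
have sE : s = #|` [fset x in S | x \in A]|%:R.
  rewrite /s -natr_sum; congr _%:R; rewrite -big_mkcond/= big_fset_condE/= sum1_size.
  by congr size; congr enum_fset; apply/fsetP => x; rewrite !inE/=; congr (_ && _);
    rewrite uA; apply/asboolP/idP.
have s1 : 1 <= s.
  rewrite sE ler1n cardfs_gt0; apply/fset0Pn; exists u; rewrite !inE/= uS/=.
  by case: Aconn.
have sS : s <= #|` S|%:R.
  by rewrite sE ler_nat; apply: fsubset_leq_card; apply/fsubsetP => x; rewrite !inE => /andP[].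
have sA : s <= #|` A|%:R.
  by rewrite sE ler_nat; apply: fsubset_leq_card; apply/fsubsetP => x; rewrite !inE => /andP[].
apply: (@le_trans _ _ (c * #|` A|%:R `^ a)).
  rewrite -mulrA ler_wpM2l ?(ltW c0)//.
  apply: (@le_trans _ _ (s `^ a)); last by apply: ge0_ler_powR; rewrite ?nnegrE//; lra.
  have s0 : 0 < s by lra.
  rewrite (powR_subr1 a s0).
  rewrite ler_wpM2r ?(ltW s0)//.
  rewrite -[leLHS]invrK -[leRHS]invrK lef_pV2 ?posrE ?invr_gt0 ?powR_gt0//; try lra.
  rewrite -!powRN opprB; apply: ge0_ler_powR; rewrite ?nnegrE; lra.
apply: (le_trans anch).
have -> : \sum_(e <- escapes S w) (`[< reach_off H outer u e.1 >])%:R =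
    #|` [fset e in escapes S w | `[< reach_off H outer u e.1 >]]|%:R :> R.
  rewrite -natr_sum; congr _%:R; rewrite -big_mkcond/= big_fset_condE/= sum1_size.
  by congr size; congr enum_fset; apply/fsetP => x; rewrite !inE/=.
rewrite ler_nat; apply: fsubset_leq_card; apply/fsubsetP => -[x y].
move=> /(boundary_reach_off_outer uA)[xyE ux]; rewrite !inE/=.
by move: xyE; rewrite !inE/= => ->; apply/asboolP.
Qed.

End Pointwise.

Lemma good_mean_escape (mu : probability (config G) R) (c a theta : R) S :
  0 < c -> 0 <= a <= 1 -> 0 <= theta -> (forall u, theta <= Pr mu (good c a u)) ->
  S != fset0 -> c * theta * #|` S|%:R `^ a <= mean_escape mu S.
Proof.
move=> c0 a01 th0 goodP S0; have cS : (0 < #|` S|)%N by rewrite cardfs_gt0.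
have K0 : 0 <= c * #|` S|%:R `^ (a - 1) by rewrite mulr_ge0 ?powR_ge0// ltW.
apply: (@le_trans _ _ (c * #|` S|%:R `^ (a - 1) * \sum_(u <- S) Pr mu (good c a u))).
  rewrite -!mulrA ler_wpM2l ?(ltW c0)//.
  rewrite (@powR_subr1 _ #|` S|%:R) ?ltr0n//.
  rewrite mulrCA ler_wpM2l ?powR_ge0//.
  apply: (@le_trans _ _ (\sum_(u <- S) theta)); last by apply: ler_sum => u _.
  by rewrite big_const_seq count_predT iter_addr_0 mulr_natr.
apply: Pr_sum_indic_le => //.
- by move=> e; exact: measurable_to_infinity_off.
- by move=> u; exact: measurable_good.
move=> w; rewrite (eq_bigr (fun u => (`[< good c a u w >])%:R : R)); last first.
  by move=> u _; rewrite indicE; congr (_ : bool)%:R; rewrite -in_setE asboolb.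
apply: (le_trans (@good_le_escapes w S c a c0 a01 S0)).
rewrite le_eqVlt; apply/orP; left; apply/eqP.
transitivity (\sum_(e <- escapes S w) (1 : R)).
  by rewrite big_const_seq count_predT iter_addr_0.
rewrite /escapes -big_fset_condE/= big_mkcond/=; apply: eq_bigr => e _.
by rewrite indicE -[RHS](_ : (`[< to_infinity_off w e.2 S >])%:R = _); [case: asboolP|
  congr (_ : bool)%:R; rewrite -in_setE asboolb].
Qed.

End GoodVertices.

(** * Large clusters with a small boundary are unlikely *)

Section Entropy.
Variable R : realType.

Lemma ln_le_self (x : R) : 0 < x -> ln x <= x.
Proof. by move=> x0; have := @le_ln1Dx R (x - 1); rewrite subrKC => h; apply: le_trans (h _) _; lra. Qed.

(** As [ln m = O(m ^ e)] for every [e > 0], the entropy [(K m) ^ (m ^ a')] is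
    negligible against [expR (c m ^ a)] when [a' < a]. The right-hand side is chosen
    because it telescopes. *)
Lemma entropy_le (K c a a' : R) : 2 <= K -> 0 < c -> 0 < a' -> a' < a ->
  exists2 m0 : nat, (0 < m0)%N & forall m, (m0 <= m)%N ->
    (K * m%:R) ^+ Num.truncn (m%:R `^ a' : R) * expR (- (c * m%:R `^ a)) <=
      m%:R^-1 - m.+1%:R^-1.
Proof.
move=> K2 c0 a'0 a'a; pose e := (a - a') / 2; have e0 : 0 < e by rewrite /e; lra.
pose X : R := 3 * (ln K + e^-1) / c.
have lnK0 : 0 <= ln K by apply: ln_ge0; lra.
have X0 : 0 <= X.
  by rewrite /X divr_ge0 ?(ltW c0)// mulr_ge0// addr_ge0// invr_ge0 ltW.
exists (Num.truncn (expR (X / e))).+1 => // m m0m.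
have Xm : expR (X / e) <= m%:R.
  have /andP[_ /ltW le] := truncn_itv (expR_ge0 (X / e)).
  by apply: (le_trans le); rewrite ler_nat.
have m1 : 1 <= m%:R :> R by rewrite ler1n; exact: leq_trans m0m.
rewrite -natr1; set x : R := m%:R in m1 Xm *; have x0 : 0 < x by lra.
have xe : x `^ e = expR (e * ln x) by rewrite /powR gt_eqF.
have Xxe : X <= x `^ e.
  rewrite xe; have : X <= e * ln x.
    by rewrite mulrC -ler_pdivrMr// -ler_expR lnK// posrE.
  by move=> /le_trans; apply; apply: le_trans (expR_ge1Dx _); lra.
have xe1 : 1 <= x `^ e by rewrite xe -[leLHS]expR0 ler_expR mulr_ge0 ?ln_ge0// ltW.
pose L := ln (K * x); have LE : L = ln K + ln x by rewrite /L lnM// posrE; lra.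
have Lxe : 3 * L <= c * X * x `^ e.
  have -> : c * X * x `^ e = 3 * (ln K * x `^ e + e^-1 * x `^ e).
    by rewrite /X; field; apply/andP; split; lra.
  have : ln x <= e^-1 * x `^ e.
    by rewrite ler_pdivlMl// -ln_powR; apply: ln_le_self; rewrite powR_gt0.
  have : ln K <= ln K * x `^ e by rewrite ler_peMr.
  by rewrite LE; lra.
have Kx1 : 1 <= K * x by nra.
have L0 : 0 <= L by exact: ln_ge0.
have LK : expR L = K * x by rewrite /L lnK// posrE; lra.
have xa : x `^ a = x `^ a' * (x `^ e * x `^ e).
  by rewrite -!powRD ?(gt_eqF x0) ?implybT//; congr (_ `^ _); rewrite /e; field.
have xa'1 : 1 <= x `^ a' by rewrite -[leLHS](powRr0 x) ler_powR// ltW.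
have kx : (Num.truncn (x `^ a'))%:R <= x `^ a' by rewrite truncn_le powR_ge0.
set k := Num.truncn _ in kx *.
apply: (@le_trans _ _ (expR (- (2 * L)))).
  rewrite -LK -expRM_natr -expRD ler_expR.
  suff : (k%:R + 2) * L <= c * x `^ a by lra.
  apply: (@le_trans _ _ (x `^ a' * (3 * L))).
    have : k%:R * L <= x `^ a' * L by rewrite ler_wpM2r.
    have : L <= x `^ a' * L by rewrite ler_peMl.
    by lra.
  rewrite xa [leRHS]mulrCA ler_wpM2l ?powR_ge0// mulrA; apply: (le_trans Lxe).
  by rewrite ler_wpM2r ?powR_ge0// ler_wpM2l// ltW.
have -> : x^-1 - (x + 1)^-1 = (x * (x + 1))^-1 by field; apply/andP; split; lra.
rewrite expRN lef_pV2 ?posrE ?expR_gt0//; last by nra.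
have -> : expR (2 * L) = (K * x) ^+ 2 by rewrite mulrC expRM_natr LK.
have : 2 * x <= K * x by rewrite ler_wpM2r// ltW.
by rewrite expr2; move: (K * x) => y y2x; nra.
Qed.

End Entropy.

Lemma card_boundary_le (V : choiceType) (H : graph V) (D : nat) (W : {fset V}) :
  locally_finite H -> (forall u, degree H u <= D)%N -> (#|` boundary H W| <= D * #|` W|)%N.
Proof.
move=> lf degD; pose N x := enum_fset (fset_set (neighbours H x)).
have := @uniq_leq_size _ (boundary H W) [seq (x, y) | x <- enum_fset W, y <- N x].
rewrite size_allpairs_dep => /(_ (fset_uniq _)) le.
have {le}/le : {subset boundary H W <= [seq (x, y) | x <- enum_fset W, y <- N x]}.
  move=> [x y]; rewrite in_boundary// => /and3P[/= xy xW _].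
  by apply/allpairsPdep; exists x, y; split => //; rewrite in_fset_set// inE.
move=> /leq_trans; apply; elim: (enum_fset W) => [|x s IH] /=; first by rewrite muln0.
by rewrite mulnS leq_add// degD.
Qed.

Section LargeClusters.
Variables (V : choiceType) (G : graph V) (R : realType).
Hypotheses (lf : locally_finite G) (eV : enumerable V).
Variables (p : R) (mu : probability (config G) R).
Hypotheses (pmu : product_law p mu) (p01 : 0 <= p < 1).
Implicit Types (W : {fset V}) (w : config G).

Definition thin_event (k : nat) (v : V) W : set (config G) :=
  [set w | connected_from (open_subgraph w) W v /\ (#|` boundary (open_subgraph w) W| <= k)%N].

Definition isolated_event (v : V) W : set (config G) :=
  [set w | connected_from (open_subgraph w) W v /\ boundary (open_subgraph w) W = fset0].

Lemma measurable_thin_event k v W : measurable (thin_event k v W).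
Proof.
apply: measurable_and; first exact: measurable_connected_from.
exact: (measurable_open_boundary lf eV (fun B => (#|` B| <= k)%N)).
Qed.

Lemma measurable_isolated_event v W : measurable (isolated_event v W).
Proof.
apply: measurable_and; first exact: measurable_connected_from.
exact: (measurable_open_boundary lf eV (fun B => B = fset0)).
Qed.

Lemma isolated_event_cluster v W w : isolated_event v W w -> cluster w v = [set` W].
Proof.
move=> [[vW conn] bd0]; rewrite clusterE; apply/seteqP; split=> u; last first.
  by move=> /conn; exact: reach_off_sub.
move: u; apply: reach_off_ind => // x y xW _ xy _; apply: contrapT => /negP yW.
have : (x, y) \in boundary (open_subgraph w) W.
  by rewrite in_boundary; [apply/and3P; split|exact: open_locally_finite].
by rewrite bd0.
Qed.

Lemma determined_connected_from v W :
  determined_by (~` touching (~` [set` W])) [set w : config G | connected_from (open_subgraph w) W v].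
Proof.
by move=> w w' ww' [vW conn]; split => // u /conn; rewrite (agree_reach_off _ ww').
Qed.

(** Connectedness within [W] is decided by edges with both endpoints in [W]. *)
Lemma Pr_connected_closed v W (B : {fset V * V}) : (B `<=` boundary G W)%fset ->
  exists F : {fset edge G}, [/\ #|` F| = #|` B|,
    forall e : edge G, e \in F <-> exists2 xy, xy \in B & val e = [fset xy.1; xy.2] &
    Pr mu ([set w : config G | connected_from (open_subgraph w) W v] `&` closed_on F) =
    Pr mu [set w : config G | connected_from (open_subgraph w) W v] * (1 - p) ^+ #|` B|].
Proof.
move=> BW; have BG e : e \in B -> [/\ adj G e.1 e.2, e.1 \in W & e.2 \notin W].
  by move=> /(fsubsetP BW); rewrite in_boundary// => /and3P[].
have [F [cF FP]] : exists F : {fset edge G}, #|` F| = #|` B| /\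
    forall e : edge G, e \in F <-> exists2 xy, xy \in B & val e = [fset xy.1; xy.2].
  apply: (edges_of_pairs (J := [set` W])) => e /BG[? ? ?]; split => //; exact/negP.
exists F; split=> //; rewrite -cF -pmu.
rewrite (Pr_independent pmu (F := ~` touching (~` [set` W]))) //.
- exact: measurable_connected_from.
- exact: measurable_closed_on.
- exact: determined_connected_from.
- move=> w w' ww' cw e eF; have [xy xyB eE] := (FP e).1 eF.
  rewrite -ww' ?cw//; apply; exists xy.2; first by rewrite eE !inE eqxx orbT.
  by have [_ _ /negP] := BG _ xyB.
Qed.

Fixpoint words (I : Type) (k : nat) (s : seq I) : seq (seq I) :=
  if k is k'.+1 then [seq i :: t | i <- s, t <- words k' s] else [:: [::]].

Lemma size_words (I : Type) k (s : seq I) : size (words k s) = (size s ^ k)%N.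
Proof. by elim: k => //= k IH; rewrite size_allpairs IH expnS. Qed.

Lemma mem_words (I : eqType) k (s t : seq I) :
  (t \in words k s) = (size t == k) && all (mem s) t.
Proof.
elim: k t => [|k IH] [|i t] //=.
  by apply/negbTE/negP => /allpairsP[[j r] []].
rewrite eqSS; apply/allpairsP/idP.
  by move=> [[j r] /= [js rw [-> ->]]]; move: rw; rewrite IH js => /andP[-> ->].
by case/and3P => st si ts; exists (i, t); rewrite /= IH si st ts.
Qed.

(** If at most [k] boundary edges of [W] are open, these can be listed in a word of
    length [k]; all the other boundary edges are closed. Closing the listed ones
    as well costs [(1 - p) ^ k] and turns [W] into a cluster. *)
Lemma Pr_thin_event_le k v W : boundary G W != fset0 ->
  (1 - p) ^+ k * Pr mu (thin_event k v W) <=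
    #|` boundary G W|%:R ^+ k * Pr mu (isolated_event v W).
Proof.
set bd := boundary G W => /fset0Pn[e0 e0bd]; have /andP[p_ge0 p_lt1] := p01.
have q0 : 0 <= 1 - p by lra.
have q1 : 1 - p <= 1 by lra.
set C := [set w : config G | connected_from (open_subgraph w) W v].
have mC : measurable C by exact: measurable_connected_from.
have isoE : Pr mu C * (1 - p) ^+ #|` bd| <= Pr mu (isolated_event v W).
  have [F [cF FP <-]] := Pr_connected_closed v (fsubset_refl bd).
  apply: le_Pr; first by apply: measurableI => //; exact: measurable_closed_on.
    exact: measurable_isolated_event.
  move=> w [Cw cw]; split => //; apply: contrapT => /eqP/fset0Pn[[x y]].
  rewrite in_boundary/=; last exact: open_locally_finite.
  move=> /and3P[/[dup] xy' /asboolP[e exy we] xW yW].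
  suff : w e = false by rewrite we.
  apply: cw; apply/FP; exists (x, y) => //.
  by rewrite in_boundary//= xW yW (open_adj_sub xy').
pose X (t : seq (V * V)) := C `&` [set w : config G |
  (boundary (open_subgraph w) W `<=` [fset e in t])%fset].
have mX t : measurable (X t).
  apply: measurableI => //.
  exact: (measurable_open_boundary lf eV (fun B => (B `<=` [fset e in t])%fset)).
apply: (@le_trans _ _ ((1 - p) ^+ k * \sum_(t <- words k bd) Pr mu (X t))).
  rewrite ler_wpM2l ?exprn_ge0//.
  apply: Pr_bigU_le => //; first exact: measurable_thin_event.
  move=> w [Cw kw]; set B := boundary (open_subgraph w) W in kw.
  have Bbd : (B `<=` bd)%fset.
    apply/fsubsetP => -[x y]; rewrite !in_boundary//=; last exact: open_locally_finite.
    by move=> /and3P[/open_adj_sub -> -> ->].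
  exists (enum_fset B ++ nseq (k - #|` B|) e0).
    rewrite mem_words size_cat size_nseq subnKC// eqxx all_cat all_nseq/=.
    by rewrite e0bd orbT andbT; apply/allP => e /(fsubsetP Bbd).
  split => //=; apply/fsubsetP => e eB; rewrite !inE.
  by rewrite eB.
rewrite mulr_sumr; apply: (@le_trans _ _ (\sum_(t <- words k bd) Pr mu (isolated_event v W))).
  rewrite big_seq [leRHS]big_seq; apply: ler_sum => t; rewrite mem_words => /andP[/eqP st tbd].
  pose B := (bd `\` [fset e in t])%fset.
  have [F [cF FP PF]] := @Pr_connected_closed v W B (fsubsetDl _ _).
  apply: le_trans isoE; apply: (@le_trans _ _ ((1 - p) ^+ k * (Pr mu C * (1 - p) ^+ #|` B|))).
    rewrite ler_wpM2l ?exprn_ge0//.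
    rewrite -PF; apply: le_Pr => //; first by apply: measurableI => //; exact: measurable_closed_on.
    move=> w [Cw /= tw]; split => // e /FP[[x y] xyB exy]; apply/negbTE/negP => we.
    move: xyB; rewrite inE => /andP[/negP xyt].
    rewrite in_boundary//= => /and3P[xy xW yW]; apply: xyt; apply: (fsubsetP tw).
    rewrite in_boundary/= ?xW ?yW ?andbT//; last exact: open_locally_finite.
    by apply/asboolP; exists e.
  rewrite mulrCA ler_wpM2l ?Pr_ge0// -exprD.
  apply: ler_wiXn2l => //.
  rewrite -(cardfsID [fset e in t] bd) leq_add2r.
  apply: leq_trans (fsubset_leq_card (fsubsetIr _ _)) _.
  by rewrite card_fseq -st size_undup.
by rewrite big_const_seq count_predT iter_addr_0 size_words -natrX mulr_natl.
Qed.


(** The sets [W] for which [isolated_event v W] holds are the cluster of [v], so these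
    events are disjoint and their probabilities add up. *)
Lemma Pr_thin_union_le (k m D : nat) v : (forall u, degree G u <= D)%N ->
  (forall W, W != fset0 -> boundary G W != fset0) -> (0 < m)%N ->
  Pr mu [set w | exists W, #|` W| = m /\ thin_event k v W w] <=
    (D.+2%:R / (1 - p) * m%:R) ^+ k *
    Pr mu [set w : config G | finite_set (cluster w v) /\ (m <= #|` fset_set (cluster w v)|)%N].
Proof.
move=> degD bd0 m0; have /andP[p_ge0 p_lt1] := p01; have q0 : 0 < 1 - p by lra.
have base0 : 0 <= D.+2%:R / (1 - p) * m%:R :> R by rewrite mulr_ge0// divr_ge0// ltW.
apply: (Pr_disjoint_domination (I := {fset V})
  (X := fun W => [set w | #|` W| = m /\ thin_event k v W w])
  (Y := fun W => [set w | #|` W| = m /\ isolated_event v W w])) => //.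
- exact: enumerable_fset.
- exact: exprn_ge0.
- apply: measurable_exists => [|W]; first exact: enumerable_fset.
  by apply: measurable_and; [exact: measurable_Prop|exact: measurable_thin_event].
- exact: measurable_cluster_size.
- by move=> W; apply: measurable_and; [exact: measurable_Prop|exact: measurable_thin_event].
- by move=> W; apply: measurable_and; [exact: measurable_Prop|exact: measurable_isolated_event].
- move=> W W' w [_ /isolated_event_cluster wW] [_ /isolated_event_cluster wW'].
  have /seteqP[WW' W'W] : [set` W] = [set` W'] by rewrite -wW -wW'.
  by apply/fsetP => x; apply/idP/idP => [/WW'|/W'W].
- move=> W w [<- /isolated_event_cluster wW] /=; rewrite wW.
  by split; [exact: finite_fset|rewrite set_fsetK].
move=> W; have [Wm|Wm] := eqVneq #|` W| m; last first.
  rewrite (_ : [set w | _ /\ thin_event k v W w] = set0).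
    by rewrite Pr_set0 mulr_ge0 ?exprn_ge0// Pr_ge0.
  by apply/seteqP; split=> w // -[/eqP]; rewrite (negbTE Wm).
rewrite (_ : [set w | _ /\ thin_event k v W w] = thin_event k v W); last first.
  by apply/seteqP; split=> w //= [].
rewrite (_ : [set w | _ /\ isolated_event v W w] = isolated_event v W); last first.
  by apply/seteqP; split=> w //= [].
have W0 : W != fset0 by rewrite -cardfs_gt0 Wm.
have := Pr_thin_event_le k v (bd0 W W0).
rewrite mulrC -ler_pdivlMr ?exprn_gt0// => /le_trans; apply.
rewrite mulrAC -expr_div_n ler_wpM2r ?Pr_ge0//.
apply: lerXn2r; rewrite ?nnegrE ?divr_ge0// ?(ltW q0)//.
rewrite mulrAC ler_wpM2r ?invr_ge0 ?(ltW q0)// -natrM ler_nat.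
apply: leq_trans (card_boundary_le W lf degD) _.
by rewrite Wm leq_mul// -addn2 leq_addr.
Qed.

Definition bad (M : nat) (a : R) (v : V) : set (config G) := [set w | exists W,
  [/\ (M <= #|` W|)%N, connected_from (open_subgraph w) W v &
      #|` boundary (open_subgraph w) W|%:R <= #|` W|%:R `^ a]].

Lemma measurable_bad M a v : measurable (bad M a v).
Proof.
apply: measurable_exists => [|W]; first exact: enumerable_fset.
have -> : [set w | [/\ (M <= #|` W|)%N, connected_from (open_subgraph w) W v &
    #|` boundary (open_subgraph w) W|%:R <= #|` W|%:R `^ a]] =
    [set w : config G | (M <= #|` W|)%N /\ (connected_from (open_subgraph w) W v /\
    #|` boundary (open_subgraph w) W|%:R <= #|` W|%:R `^ a)].
  by apply/seteqP; split=> w /=; [case=> ? ? ?|case=> ? [? ?]].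
apply: measurable_and; first exact: measurable_Prop.
apply: measurable_and; first exact: measurable_connected_from.
exact: (measurable_open_boundary lf eV (fun B => #|` B|%:R <= #|` W|%:R `^ a)).
Qed.

(** Bad sets are summed over their size [M + n]; the bound depends neither on [v] nor,
    thanks to the telescoping, on the number of sizes, and is [M ^ -1]. *)
Lemma Pr_bad_small (D : nat) (c a a' : R) : (forall u, degree G u <= D)%N ->
  (forall W, W != fset0 -> boundary G W != fset0) ->
  0 < c -> 0 < a' -> a' < a ->
  (forall v n, (0 < n)%N -> Pr mu [set w : config G |
    finite_set (cluster w v) /\ (n <= #|` fset_set (cluster w v)|)%N] <=
    expR (- (c * n%:R `^ a))) ->
  forall eps : R, 0 < eps -> exists2 M : nat, (0 < M)%N & forall v, Pr mu (bad M a' v) <= eps.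
Proof.
move=> degD bd0 c0 a'0 a'a decay eps eps0; have /andP[p_ge0 p_lt1] := p01.
have K2 : 2 <= D.+2%:R / (1 - p).
  rewrite ler_pdivlMr; last by lra.
  apply: (@le_trans _ _ 2); [by lra|by rewrite ler_nat].
have [m0 m0_gt0 entropy] := entropy_le K2 c0 a'0 a'a.
pose M := maxn m0 (Num.truncn eps^-1).+1.
have M_gt0 : (0 < M)%N by rewrite leq_max m0_gt0.
have Meps : M%:R^-1 <= eps.
  rewrite -[leRHS]invrK lef_pV2 ?posrE ?invr_gt0 ?ltr0n//.
  have /andP[_ /ltW le] : (Num.truncn eps^-1)%:R <= eps^-1 < (Num.truncn eps^-1).+1%:R.
    by apply: truncn_itv; rewrite invr_ge0 ltW.
  by apply: (le_trans le); rewrite ler_nat leq_maxr.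
exists M => // v; pose F n := [set w | exists W, #|` W| = (M + n)%N /\
  thin_event (Num.truncn ((M + n)%:R `^ a' : R)) v W w].
apply: le_trans Meps.
apply: (@Pr_bigcup_le _ _ _ _ F).
- exact: measurable_bad.
- move=> n; apply: measurable_exists => [|W]; first exact: enumerable_fset.
  by apply: measurable_and; [exact: measurable_Prop|exact: measurable_thin_event].
- move=> w [W [MW Wv small]]; exists (#|` W| - M)%N => //; exists W.
  by rewrite subnKC//; split => //; split => //; rewrite truncn_ge_nat ?powR_ge0.
move=> n; apply: (@le_trans _ _ (\sum_(i < n) ((M + i)%:R^-1 - (M + i).+1%:R^-1))).
  apply: ler_sum => i _; have Mi : (0 < M + i)%N by rewrite addn_gt0 M_gt0.
  apply: le_trans (entropy (M + i)%N _); last first.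
    by apply: leq_trans (leq_addr _ _); rewrite leq_maxl.
  apply: le_trans (Pr_thin_union_le _ v degD bd0 Mi) _.
  rewrite ler_wpM2l ?exprn_ge0 ?decay// mulr_ge0// divr_ge0//; lra.
rewrite -(big_mkord xpredT (fun i => (M + i)%:R^-1 - (M + i).+1%:R^-1)) .
under eq_bigr do rewrite -addnS -opprB.
rewrite sumrN telescope_sumr// opprB addn0 gerBl invr_ge0//.
Qed.

(** Connected sets of fewer than [M] vertices are covered by the fact that in an
    infinite cluster they have at least one open boundary edge. *)
Lemma inf_not_bad_good M a v w : (0 < M)%N -> 0 <= a <= 1 ->
  infinite_set (cluster w v) -> ~ bad M a v w -> good M%:R^-1 a v w.
Proof.
move=> M0 /andP[a0 a1] vinf nbad; split => // W Wv; rewrite ler_pdivrMl ?ltr0n//.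
have bd1 : (0 < #|` boundary (open_subgraph w) W|)%N.
  rewrite cardfs_gt0; apply: (finite_connected_boundary (open_locally_finite w lf) Wv) => //.
have [MW|MW] := leqP M #|` W|.
  have : ~ #|` boundary (open_subgraph w) W|%:R <= #|` W|%:R `^ a.
    by move=> small; apply: nbad; exists W.
  move=> /negP; rewrite -ltNge => /ltW /le_trans; apply.
  by rewrite ler_peMl// ler1n.
have W1 : 1 <= #|` W|%:R :> R.
  by rewrite ler1n cardfs_gt0; apply/fset0Pn; exists v; case: Wv.
apply: (@le_trans _ _ #|` W|%:R).
  by rewrite -[leRHS]powRr1; [rewrite ler_powR|lra].
rewrite -natrM ler_nat; apply: leq_trans (ltnW MW) _.
by rewrite leq_pmulr.
Qed.

End LargeClusters.

(** * Clusters as graphs *)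

Section EdgeBoundary.
Variables (V : choiceType) (H : graph V).

Lemma card_edge_boundary (W : {fset V}) : locally_finite H ->
  #|` fset_set (edge_boundary H W)| = #|` boundary H W|.
Proof.
move=> lf; have [F [cF FP]] : exists F : {fset edge H}, #|` F| = #|` boundary H W| /\
    forall e : edge H, e \in F <-> exists2 xy, xy \in boundary H W & val e = [fset xy.1; xy.2].
  apply: (edges_of_pairs (J := [set` W])) => e; rewrite in_boundary// => /and3P[? ? ?].
  by split => //; exact/negP.
rewrite -cF -[in RHS](set_fsetK F); congr #|` fset_set _|; apply/seteqP; split=> e /=.
  move=> [x [y [exy xW yW]]]; apply/FP; exists (x, y) => //.
  rewrite in_boundary//= xW yW andbT; have [a [b [ab eab]]] := edgeP e.
  move: exy; rewrite eab => /fset2_eq[] [ax bY]; first by rewrite -ax -bY ab.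
  by rewrite -ax -bY adj_sym ab.
move=> /FP[[x y]]; rewrite in_boundary// => /and3P[/= _ xW yW] exy.
by exists x, y.
Qed.

Variable C : set V.

Lemma reach_off_induced (x y : set_type C) :
  component (induced H C) x y <-> reach_off H (~` C) (val x) (val y).
Proof.
rewrite componentE; split.
  move: y; apply: reach_off_ind => [|a b xa _ ab _].
    by apply: reach_off_refl; apply; exact: set_valP.
  by apply: (reach_off_step xa ab); apply; exact: set_valP.
move=> xy; suff [z zy xz] : exists2 z : set_type C, val z = val y & reach_off (induced H C) set0 x z.
  by rewrite -(val_inj zy).
move: (val y) xy => u; move: u.
apply: (@reach_off_ind _ _ _ _ [set u | exists2 z : set_type C, val z = u & reach_off (induced H C) set0 x z]).
  by exists x => //; exact: reach_off_refl.
move=> _ b [z <- xz] _ zb /contrapT Cb; exists (exist (fun u => u \in C) b (mem_set Cb)) => //.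
exact: reach_off_step xz _ _.
Qed.

Hypothesis closedC : forall x y, C x -> adj H x y -> C y.

Lemma induced_locally_finite : locally_finite H -> locally_finite (induced H C).
Proof.
move=> lf x; apply: (@sub_finite_set _ _ (val @^-1` neighbours H (val x))) => //.
by apply: finite_preimage => // ? ? _ _; exact: val_inj.
Qed.

Lemma degree_induced_le (x : set_type C) : locally_finite H ->
  (degree (induced H C) x <= degree H (val x))%N.
Proof.
move=> lf; rewrite /degree.
apply: (@leq_trans #|` (val @` fset_set (neighbours (induced H C) x))%fset|).
  by rewrite card_imfset//; exact: val_inj.
apply: fsubset_leq_card; apply/fsubsetP => _ /imfsetP[y /= yx ->].
move: yx; rewrite !in_fset_set//; last exact: induced_locally_finite.
Qed.

(** Open edges leaving a part of a cluster stay in the cluster, so that passing to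
    the cluster loses no boundary edge. *)
Lemma card_boundary_induced (W : {fset set_type C}) : locally_finite H ->
  #|` boundary (induced H C) W| = #|` boundary H (val @` W)%fset|.
Proof.
move=> lf; pose f (e : set_type C * set_type C) := (val e.1, val e.2).
have finj : injective f by move=> [a b] [a' b'] [/val_inj -> /val_inj ->].
have lfC := induced_locally_finite lf.
have -> : #|` boundary (induced H C) W| = #|` (f @` boundary (induced H C) W)%fset|.
  by rewrite card_imfset.
congr #|` _|; apply/fsetP => -[x y].
rewrite in_boundary//=; apply/imfsetP/and3P => /=.
  move=> [[a b]]; rewrite in_boundary//= => /and3P[ab aW bW] [-> ->]; split => //.
    by apply/imfsetP; exists a.
  by apply: contra bW => /imfsetP[b' /= b'W /val_inj ->].
move=> [xy /imfsetP[a /= aW xa] yW]; subst x.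
have Cy : C y by apply: closedC xy; exact: set_valP.
exists (a, exist (fun u => u \in C) y (mem_set Cy)) => //.
rewrite in_boundary//; apply/and3P; split => //=.
by apply: contra yW => bW; apply/imfsetP; eexists; first exact: bW.
Qed.

Lemma reach_off_induced_within (W : {fset set_type C}) (x y : set_type C) :
  reach_off (induced H C) (~` [set` W]) x y <->
  reach_off H (~` [set` (val @` W)%fset]) (val x) (val y).
Proof.
have inW (z : set_type C) : z \in W -> val z \in (val @` W)%fset.
  by move=> zW; apply/imfsetP; exists z.
split.
  move=> xy; have [/contrapT xW _] := reach_off_notin xy.
  move: y xy; apply: reach_off_ind => [|a b xa _ ab /contrapT bW].
    by apply: reach_off_refl; apply; exact: inW.
  by apply: (reach_off_step xa ab); apply; exact: inW.
move=> xy; suff [z zy xz] : exists2 z : set_type C, val z = val y &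
    reach_off (induced H C) (~` [set` W]) x z.
  by rewrite -(val_inj zy).
have [/contrapT/= xW _] := reach_off_notin xy.
suff sub : reach_off H (~` [set` (val @` W)%fset]) (val x) `<=`
    [set u | exists2 z : set_type C, val z = u & reach_off (induced H C) (~` [set` W]) x z].
  exact: sub.
apply: reach_off_ind.
  exists x => //; apply: reach_off_refl; apply.
  by move/imfsetP: xW => [x' /= x'W /val_inj ->].
move=> _ b [z <- xz] _ zb /contrapT/imfsetP[z' /= z'W bz']; subst b; exists z' => //.
by apply: (reach_off_step xz) => //; apply.
Qed.

End EdgeBoundary.

Lemma connected_induced_from (V : choiceType) (H : graph V) (C : set V)
    (W : {fset set_type C}) (x : set_type C) : x \in W ->
  connected_graph (induced (induced H C) [set` W]) -> connected_from H (val @` W)%fset (val x).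
Proof.
move=> xW conn; split; first by apply/imfsetP; exists x.
move=> _ /imfsetP[y /= yW ->]; apply/reach_off_induced_within.
pose up z (zW : z \in W) : set_type [set` W] :=
  exist (fun u => u \in [set` W]) z (mem_set (zW : [set` W] z)).
by have /reach_off_induced := conn (up x xW) (up y yW).
Qed.

Lemma connected_from_induced (V : choiceType) (H : graph V) (C : set V)
    (W : {fset set_type C}) (x : set_type C) :
  connected_from H (val @` W)%fset (val x) -> connected_graph (induced (induced H C) [set` W]).
Proof.
move=> [_ conn] a b; apply/reach_off_induced/reach_off_induced_within.
have inW (z : set_type [set` W]) : val (val z) \in (val @` W)%fset.
  by apply/imfsetP; exists (val z) => //; exact: (set_valP z).
by apply: reach_off_trans (conn _ (inW b)); apply: reach_off_sym; exact: conn.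
Qed.

Section ClusterGraph.
Variables (V : choiceType) (G : graph V) (R : realType).
Hypothesis lf : locally_finite G.
Variables (w : config G) (v : V).
Local Notation O := (open_subgraph w).

Let lfO : locally_finite O. Proof. exact: open_locally_finite. Qed.

Lemma cluster_closed x y : cluster w v x -> adj O x y -> cluster w v y.
Proof. by rewrite clusterE => vx xy; exact: reach_off_step vx xy _. Qed.

Lemma cluster_self : cluster w v v.
Proof. by rewrite clusterE; exact: reach_off_refl. Qed.

Let v0 : set_type (cluster w v) := exist (fun u => u \in cluster w v) v (mem_set cluster_self).

Lemma anchored_isoperimetricI (D : nat) (c d : R) : (forall u, degree G u <= D)%N ->
  1 < d -> 0 < c -> anchored_at O c ((d - 1) / d) v ->
  anchored_isoperimetric (cluster_graph w v) d.
Proof.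
move=> degD d1 c0 anch; set a := (d - 1) / d.
have /andP[a0 a1] := exponent_bounds d1.
have Da : 0 < (D.+1%:R : R) `^ a by rewrite powR_gt0.
exists v0, (c / D.+1%:R `^ a); first by rewrite divr_gt0.
move=> W vW /(connected_induced_from vW) conn.
rewrite card_edge_boundary; last exact: induced_locally_finite.
rewrite card_boundary_induced//; last exact: cluster_closed.
apply: le_trans (anch _ conn); rewrite card_imfset; last exact: val_inj.
rewrite -mulrA ler_wpM2l ?(ltW c0)// ler_pdivrMl// -powRM//.
apply: ge0_ler_powR; [exact: ltW|by rewrite nnegrE|by rewrite nnegrE mulr_ge0|].
rewrite -natrM ler_nat; apply: (@leq_trans (\sum_(u <- W) D)).
  apply: leq_sum => u _; apply: leq_trans (degree_induced_le u lfO) _.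
  apply: leq_trans (degD (val u)); apply: fsubset_leq_card; apply/fsubsetP => y.
  rewrite in_fset_set; last exact: lfO.
  rewrite in_fset_set; last exact: lf.
  by rewrite !inE; exact: open_adj_sub.
by rewrite big_const_seq count_predT iter_addn_0 leq_mul2r leqnSn orbT.
Qed.

(** The anchor [x] supplied by the hypothesis is moved to [v] by adding to [W] a fixed
    path [T] from [v] to [x]. This adds at most [L] boundary edges, and as [W] has at least
    one of its own, the boundary grows by a factor at most [L + 1]. *)
Lemma anchored_isoperimetricE (d d' : R) : 1 < d' -> d' <= d ->
  infinite_set (cluster w v) -> anchored_isoperimetric (cluster_graph w v) d ->
  exists2 c : R, 0 < c & anchored_at O c ((d' - 1) / d') v.
Proof.
move=> d'1 d'd vinf [x [c c0 anch]]; have d1 : 1 < d by lra.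
have d'0 : 0 < d' by lra. have d0 : 0 < d by lra.
have aa : (d' - 1) / d' <= (d - 1) / d.
  rewrite !mulrBl !divff ?gt_eqF// lerD2l lerN2 ler_pM2l// lef_pV2//.
have Cx : cluster w v (val x) by exact: set_valP.
have [s vs [sx _]] : reach_off O set0 v (val x) by rewrite -clusterE.
pose T : {fset V} := [fset y in v :: s].
have TE y : (y \in T) = (y \in v :: s) by rewrite !inE.
have TC y : y \in T -> reach_off O (~` [set` T]) v y.
  rewrite TE => ys; have [p1 [p2 [sE yE]]] : exists p1 p2, s = p1 ++ p2 /\ y = last v p1.
    by case/splitPl: ys => p1 p2 yE; exists p1, p2.
  exists p1; first by move: vs; rewrite sE cat_path => /andP[].
  split; first by rewrite yE.
  move=> z; rewrite inE => zp; apply; rewrite /= TE inE sE mem_cat.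
  by move: zp => /predU1P[->|->]; rewrite ?eqxx ?orbT.
pose L := #|` boundary O T|.
exists (c / L.+1%:R); first by rewrite divr_gt0.
move=> W [vW conn]; pose W1 := (W `|` T)%fset.
have W1v y : y \in W1 -> reach_off O (~` [set` W1]) v y.
  by rewrite inE => /orP[/conn|/TC]; apply: reach_off_sub => // z zW1 zW; apply: zW1;
    rewrite /= inE zW ?orbT.
have W1C y : y \in W1 -> cluster w v y.
  by move=> /W1v; rewrite clusterE; exact: reach_off_sub.
pose W2 : {fset set_type (cluster w v)} := [fset z in pmap insub W1].
have W2E z : (z \in W2) = (val z \in W1) by rewrite inE mem_pmap_sub.
have W12 : (val @` W2)%fset = W1.
  apply/fsetP => y; apply/imfsetP/idP => /= [[z zW2 ->]|yW1]; first by rewrite -W2E.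
  exists (exist (fun u => u \in cluster w v) y (mem_set (W1C y yW1))) => //.
  by rewrite W2E.
have xW1 : val x \in W1 by rewrite in_fsetU TE -sx mem_last orbT.
have xW2 : x \in W2 by rewrite W2E.
have conn1 : connected_from O (val @` W2)%fset (val x).
  rewrite W12; split => // y yW1; apply: reach_off_trans (W1v _ yW1).
  by apply: reach_off_sym; exact: W1v.
have := anch W2 xW2 (connected_from_induced conn1).
rewrite card_edge_boundary; last exact: induced_locally_finite.
rewrite card_boundary_induced//; last exact: cluster_closed.
rewrite W12 => iso.
have Wv : connected_from O W v by split.
have bd1 : (0 < #|` boundary O W|)%N.
  by rewrite cardfs_gt0; exact: finite_connected_boundary lfO Wv vinf.
have bdle : (#|` boundary O W1| <= #|` boundary O W| + L)%N.
  apply: (@leq_trans #|` (boundary O W `|` boundary O T)%fset|).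
    apply: fsubset_leq_card; apply/fsubsetP => -[y z]; rewrite inE !in_boundary//=.
    move=> /and3P[-> yW zW]; move: yW zW; rewrite /W1 !in_fsetU negb_or.
    by move=> /orP[->|->] /andP[-> ->]; rewrite ?orbT.
  by rewrite cardfsU leq_subr.
have degW : (#|` W| <= \sum_(u <- W2) degree (cluster_graph w v) u)%N.
  apply: (@leq_trans #|` W1|); first by apply: fsubset_leq_card; exact: fsubsetUl.
  rewrite -W12 card_imfset; last exact: val_inj.
  apply: (@leq_trans (\sum_(u <- W2) 1)).
    by rewrite sum1_size.
  apply: leq_sum => u _; rewrite cardfs_gt0.
  have uC : cluster w v (val u) by exact: set_valP.
  have uinf : infinite_set (component O (val u)).
    rewrite componentE; apply: infinite_reach_off_eq; last first.
      by rewrite -clusterE; exact: vinf.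
    by rewrite -clusterE.
  have [y [z [yu zu yz _]]] := infinite_component_exit lfO (fset11 (val u)) uinf.
  move: yu; rewrite inE => /eqP yu; subst y.
  have Cz : cluster w v z by exact: cluster_closed uC yz.
  apply/fset0Pn; exists (exist (fun u => u \in cluster w v) z (mem_set Cz)).
  rewrite in_fset_set; last exact: induced_locally_finite.
  by rewrite inE.
rewrite mulrAC ler_pdivrMr//.
have W_gt0 : (0 < #|` W|)%N by rewrite cardfs_gt0; apply/fset0Pn; exists v.
apply: (@le_trans _ _ (c * (\sum_(u <- W2) degree (cluster_graph w v) u)%N%:R `^ ((d - 1) / d))).
  rewrite ler_wpM2l ?(ltW c0)//.
  apply: (@le_trans _ _ (#|` W|%:R `^ ((d - 1) / d))).
    by rewrite ler_powR// ler1n.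
  apply: ge0_ler_powR; rewrite ?nnegrE ?ler_nat//.
  by have /andP[/ltW] := exponent_bounds d1.
apply: (le_trans iso); rewrite -natrM ler_nat; apply: (leq_trans bdle).
by rewrite mulnS leq_add2l leq_pmull.
Qed.

End ClusterGraph.

(** * Almost sure statements *)

Lemma enumerable_countType (T : countType) : enumerable T.
Proof. by exists (fun n => choice.unpickle n) => i; exists (choice.pickle i); rewrite choice.pickleK. Qed.

Section Negligible.
Context d (T : measurableType d) (R : realType) (mu : probability T R).

Lemma negligible_exists (I : Type) (Q : I -> T -> Prop) : enumerable I ->
  (forall i, mu.-negligible [set w | Q i w]) -> mu.-negligible [set w | exists i, Q i w].
Proof.
move=> [f fP] nQ.
apply: (@negligibleS _ _ _ _ (\bigcup_n (if f n is Some i then [set w | Q i w] else set0))).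
  by move=> w [i Qi]; have [n fn] := fP i; exists n => //; rewrite fn.
apply: negligible_bigcup => n; case: (f n) => [i|]; first exact: nQ.
exact: negligible_set0.
Qed.

Lemma Pr_eq0_negligible (A : set T) : measurable A -> Pr mu A <= 0 -> mu.-negligible A.
Proof.
move=> mA A0; exists A; split => //; rewrite PrE//; congr EFin.
by apply/eqP; rewrite eq_le A0 Pr_ge0.
Qed.

Lemma negligible_Pr_eq0 (A : set T) : measurable A -> mu.-negligible A -> Pr mu A = 0.
Proof. by move=> mA /(negligibleP mu mA) A0; rewrite /Pr A0. Qed.

End Negligible.

Section Graph.
Variables (V : choiceType) (G : graph V).

Lemma connected_enumerable : connected_graph G -> locally_finite G -> enumerable V.
Proof.
move=> conn lf; have [[v _]|nv] := pselect (exists v : V, True); last first.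
  by exists (fun=> None) => v; case: nv; exists v.
pose ball := fix ball n := if n is n'.+1 then \bigcup_(u in ball n') neighbours G u else [set v].
have fball n : finite_set (ball n).
  by elim: n => [|n IH] /=; [exact: finite_set1|exact: bigcup_finite].
apply: countable_enumerable.
have -> : [set: V] = \bigcup_n ball n.
  apply/seteqP; split=> // u _; have [s vs <-] := conn v u; exists (size s) => //.
  elim/last_ind: s vs => [|s x IH]; first by [].
  rewrite rcons_path size_rcons last_rcons => /andP[/IH bs sx].
  by exists (last v s).
by apply: bigcup_countable => // n _; exact: finite_set_countable.
Qed.

Lemma transitive_bounded_degree : locally_finite G -> vertex_transitive G ->
  exists D, forall u, (degree G u <= D)%N.
Proof.
move=> lf tr; have [[v _]|nv] := pselect (exists v : V, True); last first.
  by exists 0%N => v; case: nv; exists v.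
exists (degree G v) => u; have [f [[g fg gf] fG fu]] := tr u v.
rewrite /degree; apply: (@leq_trans #|` (f @` fset_set (neighbours G u))%fset|).
  by rewrite card_imfset//; exact: can_inj fg.
apply: fsubset_leq_card; apply/fsubsetP => _ /imfsetP[y /= yu ->].
move: yu; rewrite in_fset_set; last exact: lf.
rewrite in_fset_set; last exact: lf.
by rewrite !inE /neighbours/= -fu fG.
Qed.

Lemma infinite_boundary : connected_graph G -> locally_finite G -> infinite_set [set: V] ->
  forall W : {fset V}, W != fset0 -> boundary G W != fset0.
Proof.
move=> conn lf Vinf W /fset0Pn[v vW].
have vinf : infinite_set (component G v).
  by apply: sub_infinite_set Vinf => u _; exact: conn.
have [x [y [xW yW xy _]]] := infinite_component_exit lf vW vinf.
by apply/fset0Pn; exists (x, y); rewrite in_boundary//= xy xW.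
Qed.

Lemma all_open_adj (w : config G) x y : (forall e, w e) ->
  adj (open_subgraph w) x y = adj G x y.
Proof.
move=> op; apply/idP/idP => [|xy]; first exact: open_adj_sub.
by apply/asboolP; exists (exist (is_edge G) _ (is_edge_pair xy)).
Qed.

Lemma increasing_infinite_cluster v :
  increasing_event [set w : config G | infinite_set (cluster w v)].
Proof.
move=> w w' ww' /= vinf.
have [|x] := @increasing_to_infinity _ _ [fset v] w w' ww' _; first by exists v; rewrite ?inE.
by rewrite inE => /eqP ->.
Qed.

End Graph.

Lemma between_ereal (R : realType) (x : R) (d : \bar R) : (x%:E < d)%E ->
  exists2 y : R, x < y & (y%:E < d)%E.
Proof.
case: d => [r| |] //; last by move=> _; exists (x + 1); [lra|exact: ltry].
by rewrite lte_fin => xr; exists ((x + r) / 2); [lra|rewrite lte_fin; lra].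
Qed.

Section Main.
Variables (V : choiceType) (G : graph V) (R : realType) (P : R -> probability (config G) R).
Variables (p0 : R) (d : \bar R) (D : nat).
Hypothesis P_perc : forall p : R, 0 <= p <= 1 -> bernoulli_percolation p (P p).
Hypotheses (conn : connected_graph G) (lf : locally_finite G) (Vinf : infinite_set [set: V]).
Hypotheses (d_gt1 : (1%:E < d)%E) (degD : forall u, (degree G u <= D)%N) (p0_range : 0 <= p0 < 1).

Let eV : enumerable V. Proof. exact: connected_enumerable. Qed.
Let bd0 : forall W : {fset V}, W != fset0 -> boundary G W != fset0.
Proof. exact: infinite_boundary. Qed.

Lemma Pr_decay (p d' : R) : finite_cluster_decay P p0 d -> p0 < p <= 1 -> 1 < d' -> (d'%:E < d)%E ->
  exists2 c : R, 0 < c & forall v n, (0 < n)%N -> Pr (P p) [set w : config G |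
    finite_set (cluster w v) /\ (n <= #|` fset_set (cluster w v)|)%N] <=
    expR (- (c * n%:R `^ ((d' - 1) / d'))).
Proof.
move=> decay p_range d'1 d'd; have [c c0 hc] := decay p d' p_range d'1 d'd.
exists c => // v n n0; have := hc v n n0.
by rewrite (PrE _ (measurable_cluster_size eV v n)) lee_fin.
Qed.

(** Any loss of exponent is harmless: the decay is used at some [d2] strictly between
    [d'] and [d]. *)
Lemma decay_bad_small (p d' : R) : finite_cluster_decay P p0 d -> p0 < p < 1 -> 1 < d' ->
  (d'%:E < d)%E -> forall eps : R, 0 < eps -> exists2 M : nat, (0 < M)%N &
    forall v, Pr (P p) (bad M ((d' - 1) / d') v) <= eps.
Proof.
move=> decay p_range d'1 /between_ereal[d2 d'd2 d2d].
have /andP[p0_ge0 _] := p0_range; have /andP[pp0 p_lt1] := p_range.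
have [||c c0 hc] := Pr_decay (p := p) decay _ _ d2d; [by rewrite pp0 ltW|lra|].
have p01 : 0 <= p < 1 by lra.
have pl : product_law p (P p) by apply: bernoulli_product_law; apply: P_perc; lra.
apply: (Pr_bad_small lf eV pl p01 degD bd0 c0 _ _ hc).
  by have /andP[] := exponent_bounds d'1.
have d'0 : 0 < d' by lra. have d20 : 0 < d2 by lra.
by rewrite !mulrBl !divff ?gt_eqF// ltrD2l ltrN2 !mul1r ltf_pV2.
Qed.

(** The decay at [n = 1] bounds below, uniformly in [v], the probability [theta] of an
    infinite cluster; bad sets of at least [M] vertices remove at most half of it. *)
Lemma decay_escape : finite_cluster_decay P p0 d -> boundary_escape P p0 d.
Proof.
move=> decay; have /andP[p0_ge0 p0_lt1] := p0_range.
rewrite (boundary_escapeE _ _ _ lf eV).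
have below (p d' : R) : p0 < p < 1 -> 1 < d' -> (d'%:E < d)%E -> exists2 c : R, 0 < c &
    forall S, S != fset0 -> c * #|` S|%:R `^ ((d' - 1) / d') <= mean_escape (P p) S.
  move=> p_range d'1 d'd; have /andP[pp0 p_lt1] := p_range.
  have [|c c0 hc] := Pr_decay (p := p) decay _ d'1 d'd; first by rewrite pp0 ltW.
  pose theta : R := 1 - expR (- c).
  have th0 : 0 < theta by rewrite subr_gt0 -[ltRHS]expR0 ltr_expR oppr_lt0.
  have [M M0 badM] : exists2 M : nat, (0 < M)%N &
      forall v, Pr (P p) (bad M ((d' - 1) / d') v) <= theta / 2.
    by apply: decay_bad_small => //; rewrite divr_gt0.
  have a01 : 0 <= (d' - 1) / d' <= 1.
    by have /andP[/ltW -> /ltW ->] := exponent_bounds d'1.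
  exists (M%:R^-1 * (theta / 2)); first by rewrite mulr_gt0 ?invr_gt0 ?ltr0n ?divr_gt0.
  move=> S; apply: (good_mean_escape lf eV) => //; first by rewrite invr_gt0 ltr0n.
    by rewrite ltW// divr_gt0.
  move=> v; set a := (d' - 1) / d' in badM a01 *.
  have mg := measurable_good lf eV (M%:R^-1) a v.
  have mb := measurable_bad lf eV M a v.
  have mi := measurable_infinite_cluster eV v.
  have infge : theta <= Pr (P p) [set w : config G | infinite_set (cluster w v)].
    rewrite -[X in Pr _ X]setCK Pr_setC; last exact: measurableC.
    rewrite lerD2l lerN2; apply: le_trans (le_trans _ (hc v 1%N isT)) _; last first.
      by rewrite powR1 mulr1.
    apply: le_Pr; [exact: measurableC|exact: measurable_cluster_size|].
    move=> w /contrapT fin; split => //; rewrite cardfs_gt0; apply/fset0Pn; exists v.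
    by rewrite in_fset_set// inE; exact: cluster_self.
  have : Pr (P p) [set w : config G | infinite_set (cluster w v)] <=
      Pr (P p) (good M%:R^-1 a v) + Pr (P p) (bad M a v).
    apply: le_trans (Pr_setU_le _ mg mb); apply: le_Pr => //; first exact: measurableU.
    move=> w vinf; have [bw|bw] := pselect (bad M a v w); first by right.
    by left; exact: inf_not_bad_good.
  have := badM v; lra.
move=> p d' p_range d'1 d'd; have [|c c0 hc] := below ((p0 + p) / 2) d' _ d'1 d'd; first by lra.
exists c => // S /hc cS; apply: (le_trans cS); apply: le_mean_escape => //; lra.
Qed.

Lemma negligible_closed : (P 1).-negligible [set w : config G | exists e, w e = false].
Proof.
apply: negligible_exists => [|e]; first exact: enumerable_edge.
apply: Pr_eq0_negligible; first exact: measurable_edge.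
have pl : product_law 1 (P 1) by apply: bernoulli_product_law; apply: P_perc; lra.
have := pl [fset e]; rewrite subrr cardfs1 expr1 => <-.
rewrite le_eqVlt; apply/orP; left; apply/eqP; congr Pr; apply/seteqP; split=> w /=.
  by move=> we e'; rewrite inE => /eqP ->.
by apply; rewrite inE.
Qed.

(** At [p = 1] no edge can be closed at finite cost, and the inequality for [G] itself is
    deduced from the bound on the expected number of escaping edges. *)
Lemma decay_anchored (p d' : R) v : finite_cluster_decay P p0 d -> p0 < p <= 1 -> 1 < d' ->
  (d'%:E < d)%E -> (P p).-negligible [set w | infinite_set (cluster w v) /\
    ~ exists2 c : R, 0 < c & anchored_at (open_subgraph w) c ((d' - 1) / d') v].
Proof.
move=> decay p_range d'1 d'd; have /andP[p0_ge0 p0_lt1] := p0_range.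
have a01 : 0 <= (d' - 1) / d' <= 1.
  by have /andP[/ltW -> /ltW ->] := exponent_bounds d'1.
have /andP[pp0] := p_range; rewrite le_eqVlt => /predU1P[p1|p_lt1].
  have := decay_escape decay; rewrite (boundary_escapeE _ _ _ lf eV) => esc.
  have [c c0 hc] := esc p d' p_range d'1 d'd.
  rewrite p1; apply: negligibleS negligible_closed => w [_ nc] /=.
  apply: contrapT => op; apply: nc; exists c => // W [vW _].
  have {}op e : w e by apply: contrapT => /negP/negbTE we; apply: op; exists e.
  have -> : boundary (open_subgraph w) W = boundary G W.
    apply/fsetP => e; rewrite !in_boundary//; first by rewrite all_open_adj.
    exact: open_locally_finite.
  apply: le_trans (hc W _) _; first by apply/fset0Pn; exists v.
  rewrite -[leRHS]mulr1 mulr_natl -[_ *+ _]addr0 -iter_addr -count_predT -big_const_seq.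
  by apply: ler_sum => e _; apply: Pr_le1; exact: measurable_to_infinity_off.
pose N := [set w : config G | forall M : nat, (0 < M)%N -> bad M ((d' - 1) / d') v w].
have mN : measurable N.
  apply: measurable_forall => [|M]; first exact: enumerable_nat.
  by apply: measurable_imply; [exact: measurable_Prop|exact: measurable_bad].
apply: (@negligibleS _ _ _ _ N).
  move=> w [vinf nc] M M0; apply: contrapT => nbad; apply: nc.
  have [_ anch] := inf_not_bad_good lf M0 a01 vinf nbad.
  by exists M%:R^-1 => //; rewrite invr_gt0 ltr0n.
apply: Pr_eq0_negligible => //; apply/ler_addgt0Pl => eps eps0; rewrite addr0.
have [M M0 badM] : exists2 M : nat, (0 < M)%N &
    forall v, Pr (P p) (bad M ((d' - 1) / d') v) <= eps.
  by apply: decay_bad_small => //; rewrite pp0.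
apply: le_trans (badM v); apply: le_Pr => //; first exact: measurable_bad.
by move=> w; apply.
Qed.

(** Rational exponents suffice and leave countably many null events. *)
Lemma decay_dimension : finite_cluster_decay P p0 d -> clusters_anchored_dimension P p0 d.
Proof.
move=> decay p p_range.
pose Q (vq : V * rat) (w : config G) := [/\ 1 < ratr vq.2 :> R, ((ratr vq.2)%:E < d)%E,
  infinite_set (cluster w vq.1) & ~ exists2 c : R, 0 < c &
  anchored_at (open_subgraph w) c ((ratr vq.2 - 1) / ratr vq.2) vq.1].
have : (P p).-negligible [set w | exists vq, Q vq w].
  apply: negligible_exists => [|[v q]].
    by apply: enumerable_prod => //; exact: enumerable_countType.
  have [q1|q1] := boolP (1 < ratr q :> R); last first.
    by apply: negligibleS (negligible_set0 _) => w [/= h]; rewrite h in q1.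
  have [qd|qd] := boolP ((ratr q)%:E < d)%E; last first.
    by apply: negligibleS (negligible_set0 _) => w [/= _ h]; rewrite h in qd.
  by apply: negligibleS (decay_anchored v decay p_range q1 qd) => w [].
apply: negligibleS => w /= nw; apply: contrapT => nQ; apply: nw => v vinf.
rewrite leNgt; apply/negP => dimd.
have [x x1 [dimx xd]] : exists2 x : R, 1 <= x & (anchored_dimension R (cluster_graph w v) <= x%:E)%E /\ (x%:E < d)%E.
  move: dimd; case: (anchored_dimension R (cluster_graph w v)) => [r| |] rd.
  - exists (Num.max r 1); rewrite ?le_max ?lexx ?orbT//.
    by split; [rewrite lee_fin le_max lexx|rewrite EFin_max gt_max rd].
  - by move: rd; rewrite ltNge leey.
  - by exists 1 => //; split => //; exact: leNye.
have [y xy yd] := between_ereal xd.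
have [q xqy] := rat_in_itvoo xy.
move: xqy; rewrite in_itv => /andP[/= xq qy].
have q1 : 1 < ratr q :> R by exact: le_lt_trans xq.
have qd : ((ratr q)%:E < d)%E by apply: lt_trans yd; rewrite lte_fin.
suff : ((ratr q)%:E <= anchored_dimension R (cluster_graph w v))%E.
  by move=> /le_trans/(_ dimx); rewrite lee_fin leNgt xq.
apply: ereal_sup_ubound; exists (ratr q : R) => //; split => //.
have [c c0 anch] : exists2 c : R, 0 < c &
    anchored_at (open_subgraph w) c ((ratr q - 1) / ratr q) v.
  by apply: contrapT => nc; apply: nQ; exists (v, q).
exact: anchored_isoperimetricI degD q1 c0 anch.
Qed.

End Main.

(** * Automorphism invariance *)

Lemma reach_off_map (V : choiceType) (H H' : graph V) (J J' : set V) (h : V -> V) x u :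
  (forall a b, adj H a b -> adj H' (h a) (h b)) -> (forall a, J' (h a) -> J a) ->
  reach_off H J x u -> reach_off H' J' (h x) (h u).
Proof.
move=> hH hJ xu; have [Jx _] := reach_off_notin xu.
move: u xu; apply: reach_off_ind => [|a b xa _ ab Jb].
  by apply: reach_off_refl => /hJ.
by apply: (reach_off_step xa); [exact: hH|move=> /hJ].
Qed.

Section Automorphism.
Variables (V : choiceType) (G : graph V) (R : realType).
Hypotheses (lf : locally_finite G) (eV : enumerable V).
Variables (f g : V -> V).
Hypotheses (fK : cancel f g) (gK : cancel g f) (fG : forall x y, adj G (f x) (f y) = adj G x y).

Lemma image_pair (x y : V) : (f @` [fset x; y])%fset = [fset f x; f y].
Proof.
apply/fsetP => z; rewrite !inE; apply/imfsetP/orP => /=.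
  by move=> [u]; rewrite !inE => /orP[]/eqP -> ->; [left|right].
by case=> /eqP ->; [exists x|exists y]; rewrite ?inE ?eqxx ?orbT.
Qed.

Lemma is_edge_image (e : edge G) : is_edge G (f @` val e)%fset.
Proof.
have [x [y [xy ->]]] := edgeP e; rewrite image_pair.
by apply: is_edge_pair; rewrite fG.
Qed.

Definition edge_image (e : edge G) : edge G := exist (is_edge G) _ (is_edge_image e).

Lemma edge_image_inj : injective edge_image.
Proof.
move=> e e' /(congr1 val)/= /fsetP E; apply: val_inj; apply/fsetP => x.
by have := E (f x); rewrite !mem_imfset//; exact: can_inj fK.
Qed.

Definition shift_config (w : config G) : config G := fun e => w (edge_image e).

Lemma shift_open_adj w x y :
  adj (open_subgraph (shift_config w)) x y = adj (open_subgraph w) (f x) (f y).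
Proof.
apply/idP/idP.
  move=> /asboolP[e exy we]; apply/asboolP; exists (edge_image e) => //=.
  by rewrite exy image_pair.
move=> fxy; have xy : adj G x y by rewrite -fG; exact: open_adj_sub fxy.
move/asboolP: fxy => [e exy we]; apply/asboolP.
exists (exist (is_edge G) _ (is_edge_pair xy)) => //; rewrite /shift_config.
by rewrite (_ : edge_image _ = e)//; apply: val_inj; rewrite exy/= image_pair.
Qed.

Lemma Pr_shift (p : R) (mu : probability (config G) R) (X : set (config G)) :
  product_law p mu -> measurable X -> Pr mu (shift_config @^-1` X) = Pr mu X.
Proof.
move=> pmu mX; apply: (Pr_preimage_product_law pmu) => //.
  by move=> e; exact: measurable_edge_true.
move=> A; have -> : shift_config @^-1` closed_on A = closed_on (edge_image @` A)%fset.
  apply/seteqP; split=> w /=; first by move=> h e /imfsetP[e' /= eA ->]; exact: h.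
  by move=> h e eA; apply: h; apply/imfsetP; exists e.
by rewrite pmu card_imfset//; exact: edge_image_inj.
Qed.

(** [f] is an isomorphism from the open subgraph of [shift_config w] to that of [w]. *)
Lemma shift_good w (c a : R) v : good c a v (shift_config w) -> good c a (f v) w.
Proof.
move=> [vinf anch]; split.
  move=> fin; apply: vinf; apply: (@sub_finite_set _ _ (f @^-1` cluster w (f v))).
    move=> u; rewrite /= !clusterE; apply: reach_off_map => // x y.
    by rewrite shift_open_adj.
  by apply: finite_preimage => // x y _ _; exact: can_inj fK _ _.
move=> W [vW conn].
have ginj : injective g by exact: can_inj gK.
have cW : #|` (g @` W)%fset| = #|` W| by rewrite card_imfset.
have conn' : connected_from (open_subgraph (shift_config w)) (g @` W)%fset v.
  split; first by rewrite -(fK v) mem_imfset.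
  move=> _ /imfsetP[u /= uW ->]; rewrite -[v]fK; apply: reach_off_map (conn u uW) => x.
    by move=> y; rewrite shift_open_adj !gK.
  by move=> nx xW; apply: nx; rewrite /= mem_imfset.
have := anch _ conn'; rewrite cW => /le_trans; apply; rewrite ler_nat.
pose gg (e : V * V) := (g e.1, g e.2).
apply: (@leq_trans #|` (gg @` boundary (open_subgraph w) W)%fset|).
  apply: fsubset_leq_card; apply/fsubsetP => -[x y].
  rewrite in_boundary; last exact: open_locally_finite.
  move=> /and3P[/= xy xW yW]; apply/imfsetP; exists (f x, f y); last by rewrite /gg/= !fK.
  have fxy : adj (open_subgraph w) (f x) (f y) by rewrite -shift_open_adj.
  rewrite /= in_boundary; last exact: open_locally_finite.
  have memf z : (f z \in W) = (z \in (g @` W)%fset) by rewrite -[in RHS](fK z) mem_imfset.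
  by apply/and3P; split => //=; rewrite memf.
by apply: leq_trans (leq_imfset_card _ _ _) _.
Qed.

End Automorphism.

(** * From anchored dimension to escape in transitive graphs *)

Section Transitive.
Variables (V : choiceType) (G : graph V) (R : realType) (P : R -> probability (config G) R).
Variables (p0 : R) (d : \bar R).
Hypothesis P_perc : forall p : R, 0 <= p <= 1 -> bernoulli_percolation p (P p).
Hypotheses (conn : connected_graph G) (lf : locally_finite G) (Vinf : infinite_set [set: V]).

Let eV : enumerable V. Proof. exact: connected_enumerable. Qed.

Let percolation_law p (p01 : 0 <= p <= 1) : product_law p (P p).
Proof. by apply: bernoulli_product_law; exact: P_perc. Qed.

Definition percolating : set R := [set p : R | 0 <= p <= 1 /\
  {ae P p, forall w, exists v, infinite_set (cluster w v)}].

Lemma percolating1 : percolating 1.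
Proof.
split; first by lra.
have [v _] : exists v : V, True.
  apply: contrapT => nv; apply: Vinf; apply: (@sub_finite_set _ _ set0) => // u _.
  by case: nv; exists u.
apply: negligibleS (negligible_closed P_perc conn lf) => w /= nv; apply: contrapT => op.
apply: nv; exists v; apply: sub_infinite_set Vinf => u _; rewrite clusterE.
have {}op e : w e by apply: contrapT => /negP/negbTE we; apply: op; exists e.
have := conn v u; rewrite componentE; apply: reach_off_sub => // x y _ _.
by rewrite all_open_adj.
Qed.

Lemma critical_probability_ge0 : 0 <= critical_probability P.
Proof. by apply: lb_le_inf; [exists 1; exact: percolating1|move=> p [/andP[]]]. Qed.

Lemma supercritical_cluster p : critical_probability P < p -> p <= 1 ->
  exists v, 0 < Pr (P p) [set w : config G | infinite_set (cluster w v)].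
Proof.
move=> pcp p1; have [q [/andP[q0 q1] aeq] qp] : exists2 q, percolating q & q < p.
  have hinf : has_inf percolating.
    by split; [exists 1; exact: percolating1|exists 0 => q [/andP[]]].
  have [|q pq qp] := inf_adherent _ hinf (eps := p - critical_probability P); first by lra.
  by exists q => //; rewrite addrC subrK in qp.
have mi v := measurable_infinite_cluster (G := G) eV v.
apply: contrapT => nv.
have null v : (P q).-negligible [set w : config G | infinite_set (cluster w v)].
  apply: Pr_eq0_negligible => //; rewrite leNgt; apply/negP => qv; apply: nv; exists v.
  apply: (lt_le_trans qv); apply: (le_Pr_increasing P_perc) => //; first exact: ltW.
  exact: increasing_infinite_cluster.
have : (P q).-negligible [set: config G].
  apply: negligibleS (negligibleU aeq (negligible_exists eV null)) => w _.
  by have [h|h] := pselect (exists v, infinite_set (cluster w v)); [right|left].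
by move=> /(negligible_Pr_eq0 measurableT); rewrite Pr_setT => /eqP; rewrite oner_eq0.
Qed.

(** By transitivity, the constant in the anchored isoperimetric inequality can be
    chosen so that the inequality holds at every vertex with probability bounded
    below. *)
Lemma dimension_escape : vertex_transitive G -> critical_probability P <= p0 ->
  clusters_anchored_dimension P p0 d -> boundary_escape P p0 d.
Proof.
move=> tr pc dim; rewrite (boundary_escapeE _ _ _ lf eV) => p d' p_range d'1 d'd.
have /andP[pp0 p1] := p_range; have pc0 := critical_probability_ge0.
have [v vpos] : exists v, 0 < Pr (P p) [set w : config G | infinite_set (cluster w v)].
  by apply: supercritical_cluster => //; exact: le_lt_trans pp0.
pose a := (d' - 1) / d'; have /andP[a0 a1] : 0 < a < 1 by exact: exponent_bounds.
have pl : product_law p (P p) by apply: percolation_law; lra.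
pose Gd (n : nat) : set (config G) := good n.+1%:R^-1 a v.
have mGd n : measurable (Gd n) by exact: measurable_good.
have mU : measurable (\bigcup_n Gd n) by exact: bigcupT_measurable.
have [n goodn] : exists n, 0 < Pr (P p) (Gd n).
  apply: Pr_bigcup_gt => //.
    move=> m n mn w [vinf anch]; split => // W Wv; apply: le_trans (anch W Wv).
    by rewrite ler_wpM2r ?powR_ge0// lef_pV2 ?posrE ?ltr0n// ler_nat.
  apply: (lt_le_trans vpos).
  have [N [mN N0 Nsub]] := dim p p_range.
  have N0' : Pr (P p) N = 0 by rewrite /Pr N0.
  rewrite -[leRHS]addr0 -N0'; apply: le_trans (Pr_setU_le _ mU mN).
  apply: le_Pr; [exact: measurable_infinite_cluster|exact: measurableU|].
  move=> w vinf; have [Nw|Nw] := pselect (N w); [by right|left].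
  have : forall v, infinite_set (cluster w v) -> (d <= anchored_dimension R (cluster_graph w v))%E.
    by apply: contrapT => h; apply: Nw; exact: Nsub.
  move=> /(_ v vinf) => dv.
  have [_ [e [e1 iso] <-]] := ereal_sup_gt (lt_le_trans d'd dv).
  rewrite lte_fin => /ltW d'e.
  have [c c0 anch] := anchored_isoperimetricE lf d'1 d'e vinf iso.
  exists (Num.truncn c^-1) => //; split => // W Wv; apply: le_trans (anch W Wv).
  rewrite ler_wpM2r ?powR_ge0// -[leRHS]invrK lef_pV2 ?posrE ?invr_gt0 ?ltr0n//.
  have /andP[_ /ltW] : (Num.truncn c^-1)%:R <= c^-1 < (Num.truncn c^-1).+1%:R.
    by apply: truncn_itv; rewrite invr_ge0 ltW.
  by [].
have goodu u : Pr (P p) (Gd n) <= Pr (P p) (good n.+1%:R^-1 a u).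
  have [f [[g fg gf] fG <-]] := tr v u.
  rewrite -(Pr_shift fg fG pl (mGd n)); apply: le_Pr.
  - rewrite -[X in measurable X]setTI; apply: measurable_to_config => //.
    by move=> e; exact: measurable_edge_true.
  - exact: measurable_good.
  - by move=> w; exact: shift_good.
exists (n.+1%:R^-1 * Pr (P p) (Gd n)); first by rewrite mulr_gt0// invr_gt0 ltr0n.
move=> S; apply: (good_mean_escape lf eV) => //.
- by rewrite !ltW.
- exact: ltW.
Qed.

End Transitive.

Theorem theorem1p1 (R : realType) (V : choiceType) (G : graph V)
    (P : R -> probability (config G) R) (p0 : R) (d : \bar R)
    (P_perc : forall p : R, 0 <= p <= 1 -> bernoulli_percolation p (P p))
    (G_connected : connected_graph G)
    (V_infinite : infinite_set [set: V])
    (p0_range : critical_probability P <= p0 < 1)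
    (d_gt1 : (1%:E < d)%E) :
  (locally_finite G -> vertex_transitive G ->
    [<-> disconnection_decay P p0 d;
         boundary_escape P p0 d;
         finite_cluster_decay P p0 d;
         clusters_anchored_dimension P p0 d])
  /\
  (bounded_degree G ->
    [/\ disconnection_decay P p0 d <-> boundary_escape P p0 d,
        boundary_escape P p0 d -> finite_cluster_decay P p0 d
      & finite_cluster_decay P p0 d -> clusters_anchored_dimension P p0 d]).
Proof.
have /andP[pc p0_lt1] := p0_range.
have main D : locally_finite G -> (forall u, (degree G u <= D)%N) ->
    [/\ 0 <= p0 < 1, disconnection_decay P p0 d <-> boundary_escape P p0 d,
        boundary_escape P p0 d -> finite_cluster_decay P p0 d
      & finite_cluster_decay P p0 d -> clusters_anchored_dimension P p0 d].
  move=> lf degD; have eV := connected_enumerable G_connected lf.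
  have p01 : 0 <= p0 < 1.
    by rewrite p0_lt1 andbT; apply: le_trans pc; exact: critical_probability_ge0.
  split => //.
  - split; first exact: disconnection_decay_escape.
    exact: escape_disconnection_decay.
  - exact: escape_finite_cluster_decay.
  - exact: (decay_dimension P_perc G_connected lf V_infinite d_gt1 degD p01).
split.
  move=> lf tr; have [D degD] := transitive_bounded_degree lf tr.
  have [p01 i_ii ii_iii iii_iv] := main D lf degD.
  tfae => //; first by move/i_ii.
  by move=> iv; apply/i_ii; exact: dimension_escape iv.
by move=> [D degD]; have [] := main D (fun v => (degD v).1) (fun v => (degD v).2).
Qed.
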